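(* Let $\kappa$ be a weakly compact cardinal, and let $\Sigma$ be a signature with at least one constant symbol. Then infinitary first-order intuitionistic logic over $\mathcal{L}_{\kappa^+,\kappa}$ (with signature $\Sigma$) has the disjunction and existence properties. That is: (i) if $\phi_i$ ($i<\kappa$) are sentences of $\mathcal{L}_{\kappa^+,\kappa}$ such that $\bigvee_{i<\kappa}\phi_i$ is provable, then there is $i<\kappa$ such that $\phi_i$ is already provable; (ii) if $\exists\mathbf{x}\,\phi(\mathbf{x})$ is a sentence of $\mathcal{L}_{\kappa^+,\kappa}$ that is provable, then there are closed terms $\mathbf{t}$ such that $\phi(\mathbf{t})$ is already provable. Here a sentence $\chi$ is provable if the sequent $\top\vdash\chi$ (in the empty context) is provable, from the empty theory, in the system of $\kappa$-first-order logic.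
   Context: **Language.** $\kappa$ is a regular cardinal with $\kappa^{<\kappa}=\kappa$ (this holds for weakly compact $\kappa$). A signature $\Sigma$ consists of a well-ordered set of sorts and a set of function and relation symbols, each with a type involving fewer than $\kappa$ many sorts (so symbols may take $\gamma<\kappa$ many arguments); there are $\kappa$ many variables of each sort. Formulas of $\mathcal{L}_{\kappa^+,\kappa}$ are built from atomic formulas (including equalities) using conjunctions $\bigwedge$ and disjunctions $\bigvee$ of at most $\kappa$ many formulas (provided the resulting formula has fewer than $\kappa$ free variables; the empty ones are $\top,\bot$), implication $\to$, and quantifiers $\exists\mathbf{x},\forall\mathbf{x}$ over strings $\mathbf{x}$ of fewer than $\kappa$ variables. A context is a string of fewer than $\kappa$ distinct variables. A sequent $\phi\vdash_{\mathbf{x}}\psi$ consists of formulas $\phi,\psi$ with free variables in the context $\mathbf{x}$; $\phi\dashv\vdash_{\mathbf{x}}\psi$ means both $\phi\vdash_{\mathbf{x}}\psi$ and $\psi\vdash_{\mathbf{x}}\phi$. $FV(\phi)$ is the set of free variables of $\phi$; the canonical context of $\phi$ consists of its free variables. Sentences are formulas without free variables. **Trees and bars.** For a cardinal $\gamma$, $\gamma^{<\kappa}=\bigcup_{\beta<\kappa}\gamma^{\beta}$ is the tree of functions $f:\beta\to\gamma$, $\beta<\kappa$, ordered by extension; its branches are given by elements of $\gamma^\kappa$. A bar is an upward closed set of nodes intersecting every branch. If $B$ is the set of minimal elements of a bar and $f\in B$, then $\delta_f$ denotes the level (domain) of $f$. **System of $\kappa$-first-order logic.** Provability means membership in the least class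 of sequents containing the axioms below and closed under the rules below. 1. Structural: (a) $\phi\vdash_{\mathbf{x}}\phi$. (b) From $\phi\vdash_{\mathbf{x}}\psi$ infer $\phi[\mathbf{s}/\mathbf{x}]\vdash_{\mathbf{y}}\psi[\mathbf{s}/\mathbf{x}]$, where $\mathbf{y}$ includes all variables occurring in the string of terms $\mathbf{s}$. (c) From $\phi\vdash_{\mathbf{x}}\psi$ and $\psi\vdash_{\mathbf{x}}\theta$ infer $\phi\vdash_{\mathbf{x}}\theta$. 2. Equality: (a) $\top\vdash_x x=x$. (b) $(\mathbf{x}=\mathbf{y})\wedge\phi[\mathbf{x}/\mathbf{w}]\vdash_{\mathbf{z}}\phi[\mathbf{y}/\mathbf{w}]$, where $\mathbf{x},\mathbf{y}$ are contexts of the same length and type and $\mathbf{z}$ is any context containing $\mathbf{x},\mathbf{y}$ and the free variables of $\phi$. 3. Conjunction, for each cardinal $\gamma<\kappa^+$: $\bigwedge_{i<\gamma}\phi_i\vdash_{\mathbf{x}}\phi_j$; from $\{\phi\vdash_{\mathbf{x}}\psi_i\}_{i<\gamma}$ infer $\phi\vdash_{\mathbf{x}}\bigwedge_{i<\gamma}\psi_i$. 4. Disjunction, for each cardinal $\gamma<\kappa^+$: $\phi_j\vdash_{\mathbf{x}}\bigvee_{i<\gamma}\phi_i$; from $\{\phi_i\vdash_{\mathbf{x}}\theta\}_{i<\gamma}$ infer $\bigvee_{i<\gamma}\phi_i\vdash_{\mathbf{x}}\theta$. 5. Implication (in both directions): $\phi\wedge\psi\vdash_{\mathbf{x}}\eta$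 iff $\phi\vdash_{\mathbf{x}}\psi\to\eta$. 6. Existential (both directions): $\phi\vdash_{\mathbf{x}\mathbf{y}}\psi$ iff $\exists\mathbf{y}\,\phi\vdash_{\mathbf{x}}\psi$, where no variable of $\mathbf{y}$ is free in $\psi$. 7. Universal (both directions): $\phi\vdash_{\mathbf{x}\mathbf{y}}\psi$ iff $\phi\vdash_{\mathbf{x}}\forall\mathbf{y}\,\psi$, where no variable of $\mathbf{y}$ is free in $\phi$. 8. Small distributivity, for each cardinal $\gamma<\kappa^+$: $\bigwedge_{i<\gamma}(\phi\vee\psi_i)\vdash_{\mathbf{x}}\phi\vee\bigwedge_{i<\gamma}\psi_i$. 9. Dual distributivity rule, for each cardinal $\gamma<\kappa^+$ and formulas $\phi_f$ ($f\in\gamma^{<\kappa}$): from the sequents $\bigwedge_{g\in\gamma^{\beta+1},\,g|_\beta=f}\phi_g\vdash_{\mathbf{x}}\phi_f$ for all $\beta<\kappa$, $f\in\gamma^\beta$, and $\phi_f\dashv\vdash_{\mathbf{x}}\bigvee_{\alpha<\beta}\phi_{f|_\alpha}$ for all limit $\beta<\kappa$, $f\in\gamma^\beta$, infer $\bigwedge_{f\in B}\bigvee_{\beta<\delta_f}\phi_{f|_{\beta+1}}\vdash_{\mathbf{x}}\phi_\emptyset$, where $B$ is the set of minimal elements of a given bar. 10. Transfinite transitivity rule, for each cardinal $\gamma<\kappa^+$ and formulas $\phi_f$ ($f\in\gamma^{<\kappa}$) with canonical contexts $\mathbf{y}_f$: from $\phi_f\vdash_{\mathbf{y}_f}\bigvee_{g\in\gamma^{\beta+1},\,g|_\beta=f}\exists\mathbf{x}_g\,\phi_g$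 for all $\beta<\kappa$, $f\in\gamma^\beta$, and $\phi_f\dashv\vdash_{\mathbf{y}_f}\bigwedge_{\alpha<\beta}\phi_{f|_\alpha}$ for all limit $\beta<\kappa$, $f\in\gamma^\beta$, infer $\phi_\emptyset\vdash_{\mathbf{y}_\emptyset}\bigvee_{f\in B}\exists_{\beta<\delta_f}\mathbf{x}_{f|_{\beta+1}}\bigwedge_{\beta<\delta_f}\phi_{f|_{\beta+1}}$, where $B$ is the set of minimal elements of a given bar and $\exists_{\beta<\delta_f}\mathbf{x}_{f|_{\beta+1}}$ quantifies all the strings $\mathbf{x}_{f|_{\beta+1}}$, $\beta<\delta_f$, simultaneously; provided that for every $\beta<\kappa$ and $f\in\gamma^{\beta+1}$ one has $FV(\phi_f)=FV(\phi_{f|_\beta})\cup\mathbf{x}_f$ and $\mathbf{x}_f\cap FV(\phi_{f|_\beta})=\emptyset$, and $FV(\phi_f)=\bigcup_{\alpha<\beta}FV(\phi_{f|_\alpha})$ for limit $\beta$ and $f\in\gamma^\beta$. *)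

(* Defs.v *)
From mathcomp Require Import all_boot all_order.
From mathcomp Require Import boolp classical_sets functions cardinality wochoice.

Set Implicit Arguments.
Unset Strict Implicit.
Unset Printing Implicit Defensive.
Import Order.TTheory.

Local Open Scope order_scope.
Local Open Scope classical_set_scope.
Local Open Scope card_scope.

(* A cardinal kappa is represented by an ordered type K of order type kappa:
   the elements of K are the ordinals below kappa, and K itself serves as an
   index set of cardinality kappa. *)
Section Cardinals.
Context {d : Order.disp_t} (K : orderType d).

Definition seg (a : K) : Type := {b : K | b < a}.

Definition le_kappa (I : Type) : Prop := [set: I] #<= [set: K].

Definition lt_kappa (T : Type) (A : set T) : Prop :=
  A #<= [set: K] /\ ~ ([set: K] #<= A).

(* K is an initial ordinal. *)
Definition is_cardinal : Prop :=
  wochoice.well_order (fun a b : K => a <= b) /\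
  (forall a : K, lt_kappa [set b : K | b < a]).

Definition regular : Prop :=
  forall A : set K, lt_kappa A -> exists b : K, forall a, A a -> a < b.

Definition strong_limit : Prop :=
  forall a : K, lt_kappa [set X : set K | X `<=` [set b | b < a]].

(* (T, lt) is a tree of height at most kappa with height function ht: for each
   x, ht is an order isomorphism from the predecessors of x onto the ordinal
   ht x. *)
Definition is_tree (T : Type) (lt : T -> T -> Prop) (ht : T -> K) : Prop :=
  [/\ forall x y z, lt x y -> lt y z -> lt x z,
      forall x y, lt x y -> ht x < ht y,
      forall x y z, lt x z -> lt y z -> ht x < ht y -> lt x y,
      forall x y z, lt x z -> lt y z -> ht x = ht y -> x = y &
      forall x a, a < ht x -> exists2 y, lt y x & ht y = a].

Definition tree_property : Prop :=
  forall (T : Type) (lt : T -> T -> Prop) (ht : T -> K),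
    is_tree lt ht ->
    (forall a : K, [set x | ht x = a] !=set0) ->
    (forall a : K, lt_kappa [set x | ht x = a]) ->
    exists b : K -> T,
      (forall a, ht (b a) = a) /\ (forall a a', a < a' -> lt (b a) (b a')).

Definition weakly_compact : Prop :=
  [/\ is_cardinal, ~ countable [set: K], regular, strong_limit & tree_property].

(* The successor ordinal; the default value of xget is never taken when K is an
   infinite cardinal. *)
Definition osucc (a : K) : K :=
  xget a [set b | a < b /\ forall c, a < c -> b <= c].

Definition is_limit (a : K) : Prop :=
  (exists b, b < a) /\ (forall b, b < a -> osucc b < a).

Section Trees.
Variable G : Type.

(* The tree G^{<kappa}. *)
Definition node : Type := {a : K & seg a -> G}.

Definition lvl (f : node) : K := projT1 f.

Lemma lt_min_r (a b c : K) : c < Order.min a b -> c < b.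
Proof. by rewrite lt_min => /andP[]. Qed.

Definition restr (f : node) (a : K) : node :=
  existT (fun a => seg a -> G) (Order.min a (lvl f))
    (fun b => projT2 f (exist _ (sval b) (lt_min_r (svalP b)))).

(* In particular this forces lvl f <= lvl g. *)
Definition extends (f g : node) : Prop := restr g (lvl f) = f.

Definition child (f : node) : set node :=
  [set g | lvl g = osucc (lvl f) /\ extends f g].

Definition is_root (r : node) : Prop := forall a : K, lvl r <= a.

Definition branch_node (h : K -> G) (a : K) : node :=
  existT (fun a => seg a -> G) a (fun b => h (sval b)).

Definition is_bar (U : set node) : Prop :=
  (forall f g, extends f g -> U f -> U g) /\
  (forall h : K -> G, exists a, U (branch_node h a)).

Definition minimal_nodes (U : set node) : set node :=
  [set f | U f /\ forall g, U g -> extends g f -> g = f].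

End Trees.

(* A symbol has a string of arguments indexed by an ordinal below kappa. *)
Record signature := Signature {
  sorts : Type;
  sort_le : rel sorts;
  sort_wo : wochoice.well_order sort_le;
  funsym : Type;
  farity : funsym -> K;
  fdom : forall f : funsym, seg (farity f) -> sorts;
  fcod : funsym -> sorts;
  relsym : Type;
  rarity : relsym -> K;
  rdom : forall R : relsym, seg (rarity R) -> sorts
}.

Definition is_constant (S : signature) (c : funsym S) : Prop :=
  seg (farity c) -> False.

End Cardinals.

Section Logic.
Context {d : Order.disp_t} {K : orderType d} (S : signature K).

Definition scope : Type := sorts S -> Type.

Definition svar (B : scope) : Type := {s : sorts S & B s}.

(* kappa many variables of each sort. *)
Definition V : scope := fun=> K.

Definition varset : Type := set (svar V).

Inductive term (B : scope) : sorts S -> Type :=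
| Var (s : sorts S) (b : B s) : term B s
| App (f : funsym S) (a : forall i, term B (@fdom _ _ S f i)) : term B (fcod f).

Arguments Var {B s} b.

(* Inside a quantifier over the set of variables Y, occurrences bound by that
   quantifier are inr references and all other ones are inl references, so
   that substitution cannot capture variables. *)
Definition ext (B : scope) (Y : varset) : scope :=
  fun s => (B s + {k : K | Y (existT _ s k)})%type.

(* Raw formulas; the formulas of the language are those of scope V satisfying wf
   below. *)
Inductive form (B : scope) : Type :=
| Rel (R : relsym S) (a : forall i, term B (@rdom _ _ S R i))
| Eq (s : sorts S) (t u : term B s)
| And (I : Type) (phi : I -> form B)
| Or (I : Type) (phi : I -> form B)
| Imp (phi psi : form B)
| Ex (Y : varset) (phi : form (ext B Y))
| All (Y : varset) (phi : form (ext B Y)).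

Fixpoint tfv (B : scope) (s : sorts S) (t : term B s) : set (svar B) :=
  match t with
  | @Var _ s b => [set existT _ s b]
  | App f a => \bigcup_(i in [set: _]) tfv (a i)
  end.

Fixpoint fv (B : scope) (phi : form B) : set (svar B) :=
  match phi with
  | Rel R a => \bigcup_(i in [set: _]) tfv (a i)
  | Eq s t u => tfv t `|` tfv u
  | And J phi => \bigcup_(i in [set: _]) fv (phi i)
  | Or J phi => \bigcup_(i in [set: _]) fv (phi i)
  | Imp phi psi => fv phi `|` fv psi
  | Ex Y phi | All Y phi =>
      [set v | fv phi (existT (ext B Y) (projT1 v) (inl (projT2 v)))]
  end.

Fixpoint wf (B : scope) (phi : form B) : Prop :=
  match phi with
  | Rel R a => True
  | Eq s t u => True
  | And J phi' | Or J phi' =>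
      [/\ le_kappa K J, forall i, wf (phi' i) & lt_kappa K (fv phi)]
  | Imp phi psi => wf phi /\ wf psi
  | Ex Y phi | All Y phi => lt_kappa K Y /\ wf phi
  end.

Definition subst (B C : scope) : Type := forall s : sorts S, B s -> term C s.

Fixpoint tsubst (B C : scope) (sigma : subst B C) (s : sorts S) (t : term B s) :
    term C s :=
  match t with
  | Var s b => sigma s b
  | App f a => App (fun i => tsubst sigma (a i))
  end.

Definition lift_subst (B C : scope) (Y : varset) (sigma : subst B C) :
    subst (ext B Y) (ext C Y) :=
  fun s v => match v with
             | inl b => tsubst (fun s c => Var (inl c)) (sigma s b)
             | inr y => Var (inr y)
             end.

Fixpoint fsubst (B C : scope) (sigma : subst B C) (phi : form B) : form C :=
  match phi with
  | Rel R a => Rel (fun i => tsubst sigma (a i))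
  | Eq s t u => Eq (tsubst sigma t) (tsubst sigma u)
  | And J phi => And (fun i => fsubst sigma (phi i))
  | Or J phi => Or (fun i => fsubst sigma (phi i))
  | Imp phi psi => Imp (fsubst sigma phi) (fsubst sigma psi)
  | Ex Y phi => Ex (fsubst (lift_subst sigma) phi)
  | All Y phi => All (fsubst (lift_subst sigma) phi)
  end.

(* phi[sigma/X]: only the variables in X are replaced. *)
Definition inst (X : varset) (sigma : subst V V) (phi : form V) : form V :=
  fsubst (fun s k => if pselect (X (existT _ s k)) then sigma s k
                     else Var (k : V s)) phi.

Definition bind (X : varset) : subst V (ext V X) :=
  fun s k => match pselect (X (existT _ s k)) with
             | left h => @Var (ext V X) s (inr (exist _ k h))
             | right _ => @Var (ext V X) s (inl k)
             end.

Definition ex_ (X : varset) (phi : form V) : form V := Ex (fsubst (@bind X) phi).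
Definition all_ (X : varset) (phi : form V) : form V := All (fsubst (@bind X) phi).

Definition Top : form V := And (fun x : void => match x with end).
Definition And2 (phi psi : form V) : form V :=
  And (fun b : bool => if b then phi else psi).
Definition Or2 (phi psi : form V) : form V :=
  Or (fun b : bool => if b then phi else psi).
Definition AndS (T : Type) (A : set T) (phi : T -> form V) : form V :=
  And (fun i : A => phi (val i)).
Definition OrS (T : Type) (A : set T) (phi : T -> form V) : form V :=
  Or (fun i : A => phi (val i)).

(* Contexts are taken as sets of variables rather than strings. *)
Definition sequent (X : varset) (phi psi : form V) : Prop :=
  [/\ lt_kappa K X, wf phi, wf psi, fv phi `<=` X & fv psi `<=` X].

(* A string of variables with the length and type of the context W, given as a
   sort-preserving map on W. *)
Definition vmap (x : forall s : sorts S, V s -> V s) (v : svar V) : svar V :=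
  existT _ (projT1 v) (x _ (projT2 v)).

Definition Eqs (W : varset) (x y : forall s : sorts S, V s -> V s) : form V :=
  AndS W (fun v => Eq (Var (x _ (projT2 v))) (Var (y _ (projT2 v)))).

(* Each rule also requires its conclusion to be a sequent of the language. *)
Inductive prv : varset -> form V -> form V -> Prop :=
| prv_id X phi : sequent X phi phi -> prv X phi phi
| prv_subst X Y phi psi (sigma : subst V V) :
    prv X phi psi ->
    (forall v, X v -> tfv (sigma _ (projT2 v)) `<=` Y) ->
    sequent Y (inst X sigma phi) (inst X sigma psi) ->
    prv Y (inst X sigma phi) (inst X sigma psi)
| prv_cut X phi psi theta :
    prv X phi psi -> prv X psi theta -> prv X phi theta

| prv_refl (s : sorts S) (k : V s) :
    let x : term V s := Var k in
    sequent [set existT V s k] Top (Eq x x) ->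
    prv [set existT V s k] Top (Eq x x)
| prv_leibniz (W Z : varset) (x y : forall s : sorts S, V s -> V s) phi :
    {in W &, injective (vmap x)} -> {in W &, injective (vmap y)} ->
    vmap x @` W `<=` Z -> vmap y @` W `<=` Z -> fv phi `<=` Z ->
    let phi_x := inst W (fun s k => Var (x s k)) phi in
    let phi_y := inst W (fun s k => Var (y s k)) phi in
    sequent Z (And2 (Eqs W x y) phi_x) phi_y ->
    prv Z (And2 (Eqs W x y) phi_x) phi_y

| prv_andE X (I : Type) (phi : I -> form V) (j : I) :
    sequent X (And phi) (phi j) -> prv X (And phi) (phi j)
| prv_andI X (I : Type) phi (psi : I -> form V) :
    (forall i, prv X phi (psi i)) ->
    sequent X phi (And psi) -> prv X phi (And psi)

| prv_orI X (I : Type) (phi : I -> form V) (j : I) :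
    sequent X (phi j) (Or phi) -> prv X (phi j) (Or phi)
| prv_orE X (I : Type) (phi : I -> form V) theta :
    (forall i, prv X (phi i) theta) ->
    sequent X (Or phi) theta -> prv X (Or phi) theta

| prv_impI X phi psi eta :
    prv X (And2 phi psi) eta ->
    sequent X phi (Imp psi eta) -> prv X phi (Imp psi eta)
| prv_impE X phi psi eta :
    prv X phi (Imp psi eta) ->
    sequent X (And2 phi psi) eta -> prv X (And2 phi psi) eta

| prv_exE X Y phi psi :
    X `&` Y = set0 -> Y `&` fv psi = set0 ->
    prv (X `|` Y) phi psi ->
    sequent X (ex_ Y phi) psi -> prv X (ex_ Y phi) psi
| prv_exI X Y phi psi :
    X `&` Y = set0 -> Y `&` fv psi = set0 ->
    prv X (ex_ Y phi) psi ->
    sequent (X `|` Y) phi psi -> prv (X `|` Y) phi psi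

| prv_allI X Y phi psi :
    X `&` Y = set0 -> Y `&` fv phi = set0 ->
    prv (X `|` Y) phi psi ->
    sequent X phi (all_ Y psi) -> prv X phi (all_ Y psi)
| prv_allE X Y phi psi :
    X `&` Y = set0 -> Y `&` fv phi = set0 ->
    prv X phi (all_ Y psi) ->
    sequent (X `|` Y) phi psi -> prv (X `|` Y) phi psi

| prv_small_distr X (I : Type) phi (psi : I -> form V) :
    let lhs := And (fun i => Or2 phi (psi i)) in
    let rhs := Or2 phi (And psi) in
    sequent X lhs rhs -> prv X lhs rhs

| prv_dual_distr X (G : Type) (phi : node K G -> form V)
    (U : set (node K G)) (r : node K G) :
    le_kappa K G -> is_bar U -> is_root r ->
    (forall f, prv X (AndS (child f) phi) (phi f)) ->
    (forall f, is_limit (lvl f) ->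
      let rhs := Or (fun a : seg (lvl f) => phi (restr f (sval a))) in
      prv X (phi f) rhs /\ prv X rhs (phi f)) ->
    let lhs := AndS (minimal_nodes U) (fun f =>
      Or (fun b : seg (lvl f) => phi (restr f (osucc (sval b))))) in
    sequent X lhs (phi r) -> prv X lhs (phi r)

| prv_transfinite_trans (G : Type) (phi : node K G -> form V)
    (x : node K G -> varset) (U : set (node K G)) (r : node K G) :
    le_kappa K G -> is_bar U -> is_root r ->
    (forall f g, child f g ->
      fv (phi g) = fv (phi f) `|` x g /\ x g `&` fv (phi f) = set0) ->
    (forall f, is_limit (lvl f) ->
      fv (phi f) = \bigcup_(a in [set: seg (lvl f)]) fv (phi (restr f (sval a)))) ->
    (forall f, prv (fv (phi f)) (phi f)
                   (OrS (child f) (fun g => ex_ (x g) (phi g)))) ->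
    (forall f, is_limit (lvl f) ->
      let rhs := And (fun a : seg (lvl f) => phi (restr f (sval a))) in
      prv (fv (phi f)) (phi f) rhs /\ prv (fv (phi f)) rhs (phi f)) ->
    let rhs := OrS (minimal_nodes U) (fun f =>
      ex_ (\bigcup_(b in [set: seg (lvl f)]) x (restr f (osucc (sval b))))
          (And (fun b : seg (lvl f) => phi (restr f (osucc (sval b)))))) in
    sequent (fv (phi r)) (phi r) rhs ->
    prv (fv (phi r)) (phi r) rhs.

Definition sentence (phi : form V) : Prop := wf phi /\ fv phi = set0.

Definition provable (phi : form V) : Prop := prv set0 Top phi.

Definition closed_term (s : sorts S) (t : term V s) : Prop := tfv t = set0.

End Logic.

Arguments V {d K} S _.

(* Main.v *)
Require Import Defs.
From mathcomp Require Import all_boot all_order.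
From mathcomp Require Import boolp classical_sets functions cardinality.
From Stdlib Require Import Eqdep_dec.

(** The proof attaches to every formula, read under an assignment of closed
    terms to its free variables, a property stronger than provability: the
    slash (after Kleene and Aczel).  A slashed disjunction has a slashed
    disjunct, a slashed existential has closed witnesses at which its body is
    slashed, and implications and universal formulas carry their own
    provability as part of the slash.  Two facts then give the theorem:

    - a slashed well-formed formula is provable ([slash_provable]);
    - every derivable sequent preserves the slash under each closed assignment
      of its context ([prv_preserves_slash]).

    Truth is slashed, so a provable sentence is slashed; if it is a disjunction
    or an existential, the slash hands over a slashed disjunct or instance, and
    that one is provable again.

    The preservation proof is by induction on derivations.  The rules for
    implication and universal quantification use the first fact, to turn the
    slash of the left-hand side into a proof.  The Leibniz rule requires that
    the slash be invariant under replacing closed terms by provably equal ones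
    ([slash_congr]), which comes down to deriving closed instances of the
    Leibniz rule inside the calculus ([provable_subst]); this needs two
    disjoint strings of fresh variables, supplied by regularity of kappa.

    The two infinitary tree rules are handled by walking up the tree
    ([transfinite_branch]).  For dual distributivity, a node that is not
    slashed has a child that is not slashed and limits cause no trouble, so a
    root that is not slashed would produce a branch of such nodes; the branch
    meets the bar, where the left-hand side forbids it.  For transfinite
    transitivity, the walk keeps slashed nodes and accumulates closed witnesses
    for the variables quantified on the way; where the branch meets the bar,
    the witnesses collected so far realize the corresponding disjunct. *)

Set Implicit Arguments.
Unset Strict Implicit.
Unset Printing Implicit Defensive.
Import Order.TTheory.

Local Open Scope order_scope.
Local Open Scope classical_set_scope.
Local Open Scope card_scope.

(** * Ordinals below kappa and sets of size less than kappa *)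

Section Ordinals.
Context {d : Order.disp_t} {K : orderType d} (hK : weakly_compact K).

Lemma weakly_compact_least (A : set K) :
  A !=set0 -> exists2 a, A a & forall b, A b -> a <= b.
Proof.
case: hK => -[wo _] _ _ _ _ [a0 Aa0].
have [|a [[aA amin] _]] := wo (mem A).
  by exists a0; apply/mem_set.
exists a; first by apply/set_mem.
by move=> b Ab; apply: amin; apply/mem_set.
Qed.

Lemma lt_wf : well_founded (fun a b : K => a < b).
Proof.
move=> a; apply: contrapT => na.
have [b nb bmin] := @weakly_compact_least [set b | ~ Acc (fun a b : K => a < b) b]
  (ex_intro _ a na).
apply: nb; split=> c cb; apply: contrapT => /bmin.
by rewrite leNgt cb.
Qed.

Lemma lt_ind (P : K -> Prop) :
  (forall a, (forall b, b < a -> P b) -> P a) -> forall a, P a.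
Proof. exact: (well_founded_ind lt_wf). Qed.

Lemma lt_kappa_le (T U : Type) (A : set T) (B : set U) :
  A #<= B -> lt_kappa K B -> lt_kappa K A.
Proof.
move=> AB [BK KB]; split; first exact: card_le_trans AB BK.
by move=> KA; apply: KB; exact: card_le_trans KA AB.
Qed.

Lemma lt_kappa_sub (T : Type) (A B : set T) :
  A `<=` B -> lt_kappa K B -> lt_kappa K A.
Proof. by move=> /subset_card_le; apply: lt_kappa_le. Qed.

Lemma lt_kappa_image (T U : Type) (f : T -> U) (A : set T) :
  lt_kappa K A -> lt_kappa K (f @` A).
Proof. exact: lt_kappa_le (card_image_le f A). Qed.

Lemma lt_kappa_countable (T : Type) (A : set T) :
  A #<= [set: K] -> countable A -> lt_kappa K A.
Proof.
case: hK => _ ncK _ _ _ AK cA; split=> // KA; apply: ncK.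
exact: card_le_trans KA cA.
Qed.

Lemma lt_kappa0 (T : Type) : lt_kappa K (@set0 T).
Proof. by apply: lt_kappa_countable; [exact: card_ge0 | exact: countable0]. Qed.

Lemma kappa_bounded (A : set K) : lt_kappa K A -> exists b, forall a, A a -> a < b.
Proof. by case: hK => _ _ + _ _; apply. Qed.

Lemma lt_kappa_seg (a : K) : lt_kappa K [set b : K | b < a].
Proof. by case: hK => -[_ ?] _ _ _ _. Qed.

Lemma no_max (a : K) : exists b, a < b.
Proof.
have [|b ab] := @kappa_bounded [set a].
  by apply: lt_kappa_countable; [exact: card_leT | exact: finite_set_countable].
by exists b; apply: ab.
Qed.

Lemma osuccP (a : K) : a < osucc a /\ forall c, a < c -> osucc a <= c.
Proof.
have [b ab bmin] := @weakly_compact_least [set b | a < b] (no_max a).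
exact: (@xgetI _ a [set b | a < b /\ forall c, a < c -> b <= c] b).
Qed.

Lemma lt_osucc (a : K) : a < osucc a.
Proof. by case: (osuccP a). Qed.

Lemma osucc_le (a c : K) : a < c -> osucc a <= c.
Proof. by case: (osuccP a) => _; apply. Qed.

Lemma lt_osuccE (a c : K) : (c < osucc a) = (c <= a).
Proof.
apply/idP/idP => [|ca]; last exact: le_lt_trans ca (lt_osucc a).
by apply: contraTT; rewrite -ltNge -leNgt => /osucc_le.
Qed.

(** Every ordinal is zero, a successor or a limit; this splits all inductions
    along branches below. *)
Lemma ordinal_cases (a : K) :
  [\/ forall b, a <= b, exists2 b, b < a & a = osucc b | is_limit a].
Proof.
have [a0|/existsNP[c /negP]] := pselect (forall b, a <= b); first by constructor 1.
rewrite -ltNge => ca.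
have [lim|/existsNP[b /not_implyP[ba /negP]]] :=
  pselect (forall b, b < a -> osucc b < a).
  by constructor 3; split=> //; exists c.
rewrite -leNgt => ab; constructor 2; exists b => //.
by apply/eqP; rewrite eq_le ab osucc_le.
Qed.

Lemma exists_bottom : exists o : K, forall b, o <= b.
Proof.
have [|o _ omin] := @weakly_compact_least [set: K].
  apply: contrapT => K0; case: hK => _ + _ _ _; apply.
  suff -> : [set: K] = set0 by exact: countable0.
  by rewrite -subset0 => a _; apply: K0; exists a.
by exists o => b; apply: omin.
Qed.

Definition upd (T : Type) (h : K -> T) (a : K) (t : T) : K -> T :=
  fun b => if b == a then t else h b.

Lemma upd_id (T : Type) (h : K -> T) (a : K) : upd h a (h a) = h.
Proof. by apply/funext => b; rewrite /upd; case: eqP => [->|]. Qed.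

Lemma upd_lt (T : Type) (h : K -> T) (a : K) (t : T) b : b < a -> upd h a t b = h b.
Proof. by rewrite /upd; case: eqP => // ->; rewrite ltxx. Qed.

(** Dependent choice of length kappa. A condition [R a h t] may inspect only
    the values of [h] below [a], so the choice function can be iterated by
    well-founded recursion, whatever filler is used for the values not yet
    chosen. *)
Lemma transfinite_choice (T : Type) (R : K -> (K -> T) -> T -> Prop) :
  inhabited T ->
  (forall a h h' t, (forall b, b < a -> h b = h' b) -> R a h t -> R a h' t) ->
  (forall a h, exists t, R a h t) ->
  exists h, forall a, R a h (h a).
Proof.
move=> [t0] Rloc Rex; pose next a h := sval (cid (Rex a h)).
pose F a (rec : forall b, b < a -> T) := next a (fun b =>
  match pselect (b < a) with left ba => rec b ba | right _ => t0 end).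
pose h := Fix lt_wf (fun _ => T) F.
have hE a : h a = F a (fun b _ => h b).
  rewrite /h Fix_eq // => c u v uv; congr (next c); apply/funext => b.
  by case: pselect.
exists h => a; rewrite hE /F.
set h' := fun b => _.
apply: (Rloc _ h' _ _ _ (svalP (cid (Rex a h')))) => b ba.
by rewrite /h'; case: pselect.
Qed.

(** The walk up a tree of height kappa: a property of initial segments that
    holds at zero, can be prolonged by one step and passes to limits holds
    along a whole branch. *)
Lemma transfinite_branch (T : Type) (P : K -> (K -> T) -> Prop) :
  inhabited T ->
  (forall a h h', (forall b, b < a -> h b = h' b) -> P a h -> P a h') ->
  (forall a h, (forall b, a <= b) -> P a h) ->
  (forall a h, P a h -> exists t, P (osucc a) (upd h a t)) ->
  (forall a h, is_limit a -> (forall b, b < a -> P b h) -> P a h) ->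
  exists h, forall a, P a h.
Proof.
move=> [t0] Ploc P0 Psucc Plim.
(* Guarding by [P a h] makes a suitable [t] exist at every stage, reached
   or not, as the choice lemma demands. *)
have [||a h|h hP] :=
  @transfinite_choice T (fun a h t => P a h -> P (osucc a) (upd h a t)).
- by constructor.
- move=> a h h' t hh' Ph Ph'; apply: (Ploc _ (upd h a t)).
    move=> b; rewrite lt_osuccE le_eqVlt => /orP[/eqP->|ba]; first by rewrite /upd eqxx.
    by rewrite !upd_lt// hh'.
  by apply/Ph/(Ploc _ h') => // b ba; rewrite hh'.
- have [Ph|] := pselect (P a h); last by exists t0.
  by have [t Pt] := Psucc _ _ Ph; exists t.
exists h; apply: lt_ind => a IH.
have [a0|[b ba ab]|la] := ordinal_cases a.
- exact: P0.
- by rewrite ab -[h](upd_id h b); apply: hP; apply: IH.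
- exact: Plim.
Qed.

(** The source of fresh variables: choosing values that increase strictly and
    stay above a bound of [A] never gets stuck, because fewer than kappa
    values have been used at each stage and kappa is regular. *)
Lemma injective_avoiding (A : set K) :
  lt_kappa K A -> exists f : K -> K, injective f /\ forall k, ~ A (f k).
Proof.
move=> /kappa_bounded[b Ab].
have [||a h|f fP] := @transfinite_choice K
  (fun a h t => b <= t /\ forall c, c < a -> h c < t).
- by constructor.
- by move=> a h h' t hh' [bt ht]; split=> // c ca; rewrite -hh' ?ht.
- have [c hc] := kappa_bounded (lt_kappa_image h (lt_kappa_seg a)).
  exists (Order.max b c); split; first by rewrite le_max lexx.
  by move=> x xa; rewrite lt_max (hc (h x)) ?orbT//; exists x.
exists f; split=> [x y fxy|k Afk]; last first.
  by have [+ _] := fP k; rewrite leNgt Ab.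
apply/eqP; case: ltgtP => // xy; [have := (fP y).2 _ xy|have := (fP x).2 _ xy];
  by rewrite fxy ltxx.
Qed.

Lemma lt_kappa_inj (T : Type) (A : set T) :
  lt_kappa K A -> exists e : T -> K, {in A &, injective e}.
Proof.
move=> [AK _]; have [o _] := exists_bottom.
have [f] : $|{injfun [set: A] >-> [set: [set: K]]}| by apply/card_leP.
exists (fun t => match pselect (A t) with
  | left At => val (f (SigSub (mem_set At))) | right _ => o end).
move=> t u /set_mem At /set_mem Au.
case: pselect => // At'; case: pselect => // Au' /val_inj.
by move=> /(@inj _ _ _ f _ _ (mem_set I) (mem_set I))/(congr1 val).
Qed.

Lemma inj_le_kappa (T : Type) (A : set T) (e : T -> K) :
  {in A &, injective e} -> A #<= [set: K].
Proof.
move=> /inj_card_eq; rewrite card_eqPle => -[_ Ae].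
exact: card_le_trans Ae (card_leT _).
Qed.

Lemma le_kappa_bool : le_kappa K bool.
Proof.
have [o _] := exists_bottom.
apply: (@inj_le_kappa _ _ (fun b : bool => if b then osucc o else o)).
by move=> [] [] _ _ // /eqP; rewrite ?(gt_eqF (lt_osucc o)) ?(lt_eqF (lt_osucc o)).
Qed.

(** The union injects into kappa because one of the two injections can be
    moved off the range of the other. Conversely, if kappa injected into the
    union, both preimages would be bounded, and so would kappa. *)
Lemma lt_kappaU (T : Type) (A B : set T) :
  lt_kappa K A -> lt_kappa K B -> lt_kappa K (A `|` B).
Proof.
move=> Ak Bk; have [eA eAinj] := lt_kappa_inj Ak.
have [eB eBinj] := lt_kappa_inj Bk.
have [f [finj fA]] := injective_avoiding (lt_kappa_image eA Ak).
split.
  apply: (@inj_le_kappa _ _ (fun t => if pselect (A t) then eA t else f (eB t))).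
  move=> t u /set_mem ABt /set_mem ABu.
  case: pselect => At; case: pselect => Au.
  - by apply: eAinj; apply/mem_set.
  - by move=> tu; case: (fA (eB u)); exists t.
  - by move=> tu; case: (fA (eB t)); exists u.
  - by move=> /finj; apply: eBinj; apply/mem_set; [case: ABt | case: ABu].
move=> /card_leP[g].
pose gv k := val (g (SigSub (mem_set (I : [set: K] k)))).
have gAB k : (A `|` B) (gv k) by apply/set_mem/(valP (g _)).
have ginj : injective gv.
  move=> k l /val_inj.
  by move=> /(@inj _ _ _ g _ _ (mem_set I) (mem_set I))/(congr1 val).
have bnd (C : set T) : lt_kappa K C -> exists b, forall k, C (gv k) -> k < b.
  move=> Ck; apply: (@kappa_bounded [set k | C (gv k)]).
  case: Ck => CK KC; have pC : [set k | C (gv k)] #<= C.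
    by apply: card_ge_preimage => x y _ _ /ginj.
  by split; [exact: card_leT | move=> /card_le_trans/(_ pC)].
have [a Aa] := bnd _ Ak; have [b Bb] := bnd _ Bk.
have [/Aa|/Bb] := gAB (Order.max a b); rewrite gt_max ltxx ?andbF//.
Qed.
End Ordinals.

(** * Substitution and free variables *)

Section Substitution.
Context {d : Order.disp_t} {K : orderType d} (S : signature K).
Implicit Types B C D : scope S.

Definition idsubst B : subst B B := fun s b => @Var _ _ S B s b.

Definition scomp B C D (tau : subst C D) (sigma : subst B C) : subst B D :=
  fun s b => tsubst tau (sigma s b).

Definition agree B C (A : set (svar B)) (sigma tau : subst B C) : Prop :=
  forall v, A v -> sigma (projT1 v) (projT2 v) = tau (projT1 v) (projT2 v).

(** The renaming under which [lift_subst] carries terms past a quantifier. *)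
Definition wk C Y : subst C (ext C Y) := fun s c => @Var _ _ S (ext C Y) s (inl c).

Lemma agree_sub B C (A A' : set (svar B)) (sigma tau : subst B C) :
  A' `<=` A -> agree A sigma tau -> agree A' sigma tau.
Proof. by move=> AA' st v /AA'/st. Qed.

Lemma agree_sym B C (A : set (svar B)) (sigma tau : subst B C) :
  agree A sigma tau -> agree A tau sigma.
Proof. by move=> st v /st. Qed.

Lemma tsubst_agree B C (sigma tau : subst B C) s (t : term B s) :
  agree (tfv t) sigma tau -> tsubst sigma t = tsubst tau t.
Proof.
elim: t => [{}s b st|f a IH st] /=; first exact: (st (existT _ s b)).
congr App; apply: functional_extensionality_dep => i.
by apply: IH => v vi; apply: st; exists i.
Qed.

Lemma tsubst_comp B C D (tau : subst C D) (sigma : subst B C) s (t : term B s) :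
  tsubst tau (tsubst sigma t) = tsubst (scomp tau sigma) t.
Proof.
elim: t => [//|f a IH] /=.
by congr App; apply: functional_extensionality_dep => i; apply: IH.
Qed.

Lemma tsubst_id B s (t : term B s) : tsubst (@idsubst B) t = t.
Proof.
elim: t => [//|f a IH] /=.
by congr App; apply: functional_extensionality_dep => i; apply: IH.
Qed.

Lemma tfv_tsubst B C (sigma : subst B C) s (t : term B s) :
  tfv (tsubst sigma t) =
  \bigcup_(v in tfv t) tfv (sigma (projT1 v) (projT2 v)).
Proof.
elim: t => [{}s b|f a IH] /=; first by rewrite bigcup_set1.
apply/seteqP; split=> [w [i _]|w [v [i _ vi] wv]].
  by rewrite IH => -[v vi wv]; exists v => //; exists i.
by exists i => //; rewrite IH; exists v.
Qed.

Lemma tsubst_closed B (sigma : subst B B) s (t : term B s) :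
  tfv t = set0 -> tsubst sigma t = t.
Proof.
by move=> t0; rewrite -[RHS]tsubst_id; apply: tsubst_agree; rewrite t0.
Qed.

Lemma lift_agree B C Y (A : set (svar (ext B Y))) (sigma tau : subst B C) :
  agree [set v | A (existT (ext B Y) (projT1 v) (inl (projT2 v)))] sigma tau ->
  agree A (lift_subst (Y:=Y) sigma) (lift_subst tau).
Proof. by move=> st [s [b|y]] //= Ab; rewrite (st (existT _ s b)). Qed.

Lemma fsubst_agree B (phi : form B) C (sigma tau : subst B C) :
  agree (fv phi) sigma tau -> fsubst sigma phi = fsubst tau phi.
Proof.
elim: phi C sigma tau => {B} [B R a|B s t u|B I phi IH|B I phi IH
  |B phi IHp psi IHq|B Y phi IH|B Y phi IH] C sigma tau st /=.
- congr Rel; apply: functional_extensionality_dep => i.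
  by apply: tsubst_agree => v vi; apply: st; exists i.
- by congr Eq; apply: tsubst_agree => v vt; apply: st; [left|right].
- by congr And; apply: funext => i; apply: IH => v vi; apply: st; exists i.
- by congr Or; apply: funext => i; apply: IH => v vi; apply: st; exists i.
- by congr Imp; [apply: IHp|apply: IHq] => v vi; apply: st; [left|right].
- by congr Ex; apply: IH; apply: lift_agree.
- by congr All; apply: IH; apply: lift_agree.
Qed.

Lemma lift_comp B C D Y (tau : subst C D) (sigma : subst B C) :
  scomp (lift_subst (Y:=Y) tau) (lift_subst sigma) = lift_subst (scomp tau sigma).
Proof.
apply: functional_extensionality_dep => s; apply: functional_extensionality_dep.
by move=> [b|y] //=; rewrite /scomp/= !tsubst_comp.
Qed.

Lemma fsubst_comp B (phi : form B) C D (tau : subst C D) (sigma : subst B C) :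
  fsubst tau (fsubst sigma phi) = fsubst (scomp tau sigma) phi.
Proof.
elim: phi C D sigma tau => {B} [B R a|B s t u|B I phi IH|B I phi IH
  |B phi IHp psi IHq|B Y phi IH|B Y phi IH] C D sigma tau /=.
- by congr Rel; apply: functional_extensionality_dep => i; apply: tsubst_comp.
- by rewrite !tsubst_comp.
- by congr And; apply: funext => i.
- by congr Or; apply: funext => i.
- by rewrite IHp IHq.
- by rewrite IH lift_comp.
- by rewrite IH lift_comp.
Qed.

Lemma lift_id B Y : lift_subst (Y:=Y) (@idsubst B) = @idsubst (ext B Y).
Proof.
by apply: functional_extensionality_dep => s; apply: functional_extensionality_dep => -[].
Qed.

Lemma fsubst_id B (phi : form B) : fsubst (@idsubst B) phi = phi.
Proof.
elim: phi => {B} [B R a|B s t u|B I phi IH|B I phi IH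
  |B phi IHp psi IHq|B Y phi IH|B Y phi IH] /=.
- by congr Rel; apply: functional_extensionality_dep => i; apply: tsubst_id.
- by rewrite !tsubst_id.
- by congr And; apply: funext => i.
- by congr Or; apply: funext => i.
- by rewrite IHp IHq.
- by rewrite lift_id IH.
- by rewrite lift_id IH.
Qed.

Definition fv_image B C (sigma : subst B C) (A : set (svar B)) : set (svar C) :=
  \bigcup_(v in A) tfv (sigma (projT1 v) (projT2 v)).

Definition inlv B Y (v : svar B) : svar (ext B Y) :=
  existT (ext B Y) (projT1 v) (inl (projT2 v)).

(** A partial inverse of [inlv]; it separates free from bound references in
    statements about dependent pairs. *)
Definition free_part B Y (v : svar (ext B Y)) : option (svar B) :=
  match v with
  | existT s (inl b) => Some (existT _ s b)
  | existT _ (inr _) => None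
  end.

Lemma inlvK B Y : pcancel (@inlv B Y) (@free_part B Y).
Proof. by case. Qed.

Lemma inlv_inj B Y : injective (@inlv B Y).
Proof. exact: pcan_inj (@inlvK B Y). Qed.

Lemma tfv_wk B Y s (t : term B s) : tfv (tsubst (wk Y) t) = inlv Y @` tfv t.
Proof.
rewrite tfv_tsubst; apply/seteqP; split=> [w [v vt ->]|w [v vt <-]];
  by exists v.
Qed.

Lemma fv_lift B C Y (sigma : subst B C) (A : set (svar (ext B Y))) (w : svar C) :
  fv_image (lift_subst sigma) A (inlv Y w) ->
  fv_image sigma [set v | A (inlv Y v)] w.
Proof.
move=> [[s [b|y]] /= Ab]; last by move=> /(congr1 (@free_part _ _)); rewrite inlvK.
rewrite tfv_wk => -[v vb /inlv_inj <-].
by exists (existT _ s b).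
Qed.

Lemma fv_image_sub B C (sigma : subst B C) (A A' : set (svar B)) :
  A `<=` A' -> fv_image sigma A `<=` fv_image sigma A'.
Proof. by move=> AA' w [v /AA' ? ?]; exists v. Qed.

Lemma fv_fsubst B (phi : form B) C (sigma : subst B C) :
  fv (fsubst sigma phi) `<=` fv_image sigma (fv phi).
Proof.
elim: phi C sigma => {B} [B R a|B s t u|B I phi IH|B I phi IH
  |B phi IHp psi IHq|B Y phi IH|B Y phi IH] C sigma /=.
- by move=> w [i _]; rewrite tfv_tsubst; apply: fv_image_sub w => v vi; exists i.
- by move=> w []; rewrite tfv_tsubst; apply: fv_image_sub w => v vi; [left|right].
- by move=> w [i _ /IH]; apply: fv_image_sub w => v vi; exists i.
- by move=> w [i _ /IH]; apply: fv_image_sub w => v vi; exists i.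
- by move=> w [/IHp|/IHq]; apply: fv_image_sub w => v vi; [left|right].
- by move=> w /IH/fv_lift.
- by move=> w /IH/fv_lift.
Qed.

Definition closed_on B C (A : set (svar B)) (sigma : subst B C) : Prop :=
  forall v, A v -> tfv (sigma (projT1 v) (projT2 v)) = set0.

Lemma closed_on_sub B C (A A' : set (svar B)) (sigma : subst B C) :
  A' `<=` A -> closed_on A sigma -> closed_on A' sigma.
Proof. by move=> AA' st v /AA'/st. Qed.

Lemma fv_fsubst_closed B (phi : form B) C (sigma : subst B C) :
  closed_on (fv phi) sigma -> fv (fsubst sigma phi) = set0.
Proof.
by move=> cl; rewrite -subset0 => w /fv_fsubst[v /cl ->].
Qed.

Lemma tfv_closed_on B C (sigma : subst B C) s (t : term B s) :
  closed_on (tfv t) sigma -> tfv (tsubst sigma t) = set0.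
Proof. by move=> cl; rewrite tfv_tsubst -subset0 => w [v /cl ->]. Qed.

(** Well-formedness bounds the number of free variables of the conjunctions
    and disjunctions inside a formula. A thin substitution does not increase
    that number, so the bound survives without counting the variables of
    terms. Renamings and substitutions of closed terms are the cases that
    occur. *)
Definition thin B C (A : set (svar B)) (sigma : subst B C) : Prop :=
  forall v, A v -> is_subset1 (tfv (sigma (projT1 v) (projT2 v))).

Lemma closed_thin B C (A : set (svar B)) (sigma : subst B C) :
  closed_on A sigma -> thin A sigma.
Proof. by move=> cl v /cl -> w w' []. Qed.

Lemma thin_lift B C Y (A : set (svar (ext B Y))) (sigma : subst B C) :
  thin [set v | A (inlv Y v)] sigma -> thin A (lift_subst sigma).
Proof.
move=> th [s [b|y]] /= Ab; last by move=> w w' -> ->.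
by rewrite tfv_wk => _ _ [v vb <-] [v' vb' <-]; rewrite (th (existT _ s b) Ab v v').
Qed.

Hypothesis hK : weakly_compact K.

Lemma lt_kappa_fv_image B C (A : set (svar B)) (sigma : subst B C) :
  thin A sigma -> lt_kappa K A -> lt_kappa K (fv_image sigma A).
Proof.
move=> th Ak.
have [->|/set0P[w0 _]] := eqVneq (fv_image sigma A) set0; first exact: lt_kappa0.
pose g v := if pselect (exists w, tfv (sigma (projT1 v) (projT2 v)) w) is left e
  then sval (cid e) else w0.
apply: lt_kappa_sub (lt_kappa_image g Ak) => w [v Av vw]; exists v => //.
rewrite /g; case: pselect => [e|[]]; last by exists w.
by apply: (th v Av) => //; exact: svalP (cid e).
Qed.

Lemma wf_fsubst B (phi : form B) C (sigma : subst B C) :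
  wf phi -> thin (fv phi) sigma -> wf (fsubst sigma phi).
Proof.
elim: phi C sigma => {B} [B R a|B s t u|B I phi IH|B I phi IH
  |B phi IHp psi IHq|B Y phi IH|B Y phi IH] C sigma //=.
- move=> [Ik wfphi fvk] th; split=> //.
    by move=> i; apply: IH => // v vi; apply: th; exists i.
  by apply: lt_kappa_sub (lt_kappa_fv_image th fvk); exact: (@fv_fsubst _ (And phi)).
- move=> [Ik wfphi fvk] th; split=> //.
    by move=> i; apply: IH => // v vi; apply: th; exists i.
  by apply: lt_kappa_sub (lt_kappa_fv_image th fvk); exact: (@fv_fsubst _ (Or phi)).
- move=> [wfp wfq] th.
  by split; [apply: IHp|apply: IHq] => // v vi; apply: th; [left|right].
- by move=> [Yk wfphi] th; split=> //; apply: IH => //; apply: thin_lift.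
- by move=> [Yk wfphi] th; split=> //; apply: IH => //; apply: thin_lift.
Qed.

(** A subformula under a quantifier has only the free variables of the
    quantified formula and the variables bound there, and a quantifier binds
    fewer than kappa of them. *)
Lemma lt_kappa_fv_ext B Y (A : set (svar (ext B Y))) :
  lt_kappa K Y -> lt_kappa K [set v | A (inlv Y v)] -> lt_kappa K A.
Proof.
move=> Yk Ak.
pose inr_ (y : set_type Y) : svar (ext B Y) :=
  existT (ext B Y) (projT1 (val y)) (inr (exist _ (projT2 (val y))
    (eq_ind _ Y (set_mem (valP y)) _ (sigT_eta (val y))))).
have Yk' : lt_kappa K [set: set_type Y].
  by apply: lt_kappa_le Yk; move: (card_setT Y); rewrite card_eqPle => -[].
apply: lt_kappa_sub (lt_kappaU hK (lt_kappa_image (@inlv B Y) Ak)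
                                  (lt_kappa_image inr_ Yk')) => -[s [b|[k Yk0]]] Ab.
  by left; exists (existT _ s b).
right; exists (SigSub (mem_set Yk0)) => //.
rewrite /inr_ /=; congr existT; congr inr; congr exist; exact: Prop_irrelevance.
Qed.

(** A subformula has only the free variables of the whole formula and the
    variables bound above it, so the conditions on numbers of free variables
    follow from the one assumed here; the other conditions do not see the
    substitution. This recovers well-formedness of the formula in the Leibniz
    rule, which constrains only instances of it. *)
Lemma wf_of_fsubst B (phi : form B) C (sigma : subst B C) :
  lt_kappa K (fv phi) -> wf (fsubst sigma phi) -> wf phi.
Proof.
elim: phi C sigma => {B} [B R a|B s t u|B I phi IH|B I phi IH
  |B phi IHp psi IHq|B Y phi IH|B Y phi IH] C sigma //= fvk.
- move=> [Ik wfphi _]; split=> // i; apply: IH (wfphi i).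
  by apply: lt_kappa_sub fvk => v vi; exists i.
- move=> [Ik wfphi _]; split=> // i; apply: IH (wfphi i).
  by apply: lt_kappa_sub fvk => v vi; exists i.
- by move=> [wfp wfq]; split; [apply: IHp wfp|apply: IHq wfq];
  apply: lt_kappa_sub fvk => v vi; [left|right].
- by move=> [Yk wfphi]; split=> //; apply: IH wfphi; apply: (lt_kappa_fv_ext Yk fvk).
- by move=> [Yk wfphi]; split=> //; apply: IH wfphi; apply: (lt_kappa_fv_ext Yk fvk).
Qed.
End Substitution.

(** * Closed instances of derivations *)

Section Derivations.
Context {d : Order.disp_t} {K : orderType d} (hK : weakly_compact K).
Context (S : signature K).
Implicit Types (B C : scope S) (X Y Z W : varset S).

Lemma prv_sequent X phi psi : prv X phi psi -> sequent X phi psi.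
Proof. by elim=> // {}X {}phi {}psi theta _ [? ? _ ? _] _ [_ _ ? _ ?]; split. Qed.

Lemma instE X (sigma : subst (V S) (V S)) (phi : form (V S)) :
  fv phi `<=` X -> inst X sigma phi = fsubst sigma phi.
Proof.
move=> fvX; apply: fsubst_agree => -[s k] /fvX Xk /=.
by case: pselect.
Qed.

(** Closed instances need no room for new variables, so they are derivable in
    the empty context, which is where provability is defined. *)
Lemma prv_closed X (rho : subst (V S) (V S)) phi psi :
  prv X phi psi -> closed_on X rho -> prv set0 (fsubst rho phi) (fsubst rho psi).
Proof.
move=> p cl; have [_ wfp wfq fvp fvq] := prv_sequent p.
have clp := closed_on_sub fvp cl; have clq := closed_on_sub fvq cl.
rewrite -(instE rho fvp) -(instE rho fvq); apply: prv_subst => //.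
  by move=> v /cl ->.
rewrite !instE//; split.
- exact: lt_kappa0.
- by apply: wf_fsubst => //; exact: closed_thin.
- by apply: wf_fsubst => //; exact: closed_thin.
- by rewrite fv_fsubst_closed.
- by rewrite fv_fsubst_closed.
Qed.

Lemma fsubst_Top (rho : subst (V S) (V S)) : fsubst rho (Top S) = Top S.
Proof. by congr And; apply: funext => -[]. Qed.

Lemma provable_closed X (rho : subst (V S) (V S)) phi :
  prv X (Top S) phi -> closed_on X rho -> provable (fsubst rho phi).
Proof. by move=> p /(prv_closed p); rewrite fsubst_Top. Qed.

Lemma provable_sentence (phi : form (V S)) : provable phi -> sentence phi.
Proof. by case/prv_sequent => _ _ wfp _; rewrite subset0. Qed.

Lemma wf_Top : wf (Top S).
Proof.
have fv0 : fv (Top S) = set0 by rewrite -subset0 => w [[]].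
split=> [|[]|].
  by apply: (@inj_le_kappa _ _ _ _ (fun v : void => match v with end)) => -[].
by rewrite -/(fv (Top S)) fv0; exact: lt_kappa0.
Qed.

Lemma sequent_Top (phi : form (V S)) : sentence phi -> sequent set0 (Top S) phi.
Proof.
move=> [wfp fvp]; split=> //.
- exact: lt_kappa0.
- exact: wf_Top.
- by move=> w [[]].
- by rewrite fvp.
Qed.

Lemma provable_And (I : Type) (phi : I -> form (V S)) :
  wf (And phi) -> (forall i, provable (phi i)) -> provable (And phi).
Proof.
move=> wfp p; apply: prv_andI => //; apply: sequent_Top; split=> //.
by rewrite -subset0 => w [i _ wi]; have [_ <-] := provable_sentence (p i).
Qed.

Lemma provable_Or (I : Type) (phi : I -> form (V S)) i :
  sentence (Or phi) -> provable (phi i) -> provable (Or phi).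
Proof.
move=> [wfp fvp] p; have [_ _ ? _ ?] := prv_sequent p.
apply: prv_cut p _; apply: prv_orI; split=> //; first exact: lt_kappa0.
by rewrite fvp.
Qed.

(** An assignment for the body of a quantifier, from one for the quantified
    formula and one for the bound variables. The second is total on named
    variables so that one can switch between the body and the formula with its
    bound variables named ([scomp_join_bind]). *)
Definition join B C Y (rho : subst B C) (tau : subst (V S) C) : subst (ext B Y) C :=
  fun s v => match v with inl b => rho s b | inr y => tau s (sval y) end.

Lemma scomp_join B C D Y (rho : subst C D) (tau : subst (V S) D) (sigma : subst B C) :
  scomp (join (Y:=Y) rho tau) (lift_subst sigma) = join (scomp rho sigma) tau.
Proof.
apply: functional_extensionality_dep => s; apply: functional_extensionality_dep.
by move=> [b|y] //=; rewrite /scomp/= tsubst_comp.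
Qed.

Lemma closed_on_join B C Y (rho : subst B C) (tau : subst (V S) C)
    (A : set (svar (ext B Y))) :
  closed_on [set v | A (inlv Y v)] rho -> closed_on Y tau ->
  closed_on A (join rho tau).
Proof.
move=> clr clt [s [b|y]] /= Ab; first exact: (clr (existT _ s b)).
exact: (clt (existT _ s (sval y)) (svalP y)).
Qed.

(** The bound variables keep their names in [Y]; naming them turns the body,
    whose other variables are already closed, into a formula [psi] whose free
    variables lie in [Y], and whose existential closure is the given formula.
    The existential rule applied to an identity gives a sequent in context
    [Y], and instantiating it by [tau] yields the claim. *)
Lemma provable_Ex B Y (phi : form (ext B Y)) (rho : subst B (V S))
    (tau : subst (V S) (V S)) :
  wf (Ex phi) -> closed_on (fv (Ex phi)) rho -> closed_on Y tau ->
  provable (fsubst (join rho tau) phi) -> provable (fsubst rho (Ex phi)).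
Proof.
move=> wfE clr clt p; have [Yk wfp] := wfE.
pose psi := fsubst (join (Y:=Y) rho (@idsubst _ _ S (V S))) phi.
have exE : ex_ Y psi = fsubst rho (Ex phi).
  rewrite /ex_ /psi fsubst_comp /=; congr Ex.
  apply: fsubst_agree => -[s [b|[k Yk0]]] /= vb.
    by rewrite /scomp /=; apply: tsubst_agree; rewrite (clr (existT _ s b) vb).
  rewrite /scomp /= /bind; case: pselect => // h; congr Var; congr inr; congr exist.
  exact: Prop_irrelevance.
have senE : sentence (fsubst rho (Ex phi)).
  split; last exact: fv_fsubst_closed.
  by apply: wf_fsubst => //; exact: closed_thin.
have fvpsi : fv psi `<=` Y.
  move=> w /fv_fsubst[[s [b|[k Yk0]]] /= vb]; last by move=> ->.
  by rewrite (clr (existT _ s b) vb).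
have wfpsi : wf psi.
  apply: wf_fsubst => // -[s [b|[k Yk0]]] /= vb; last by move=> w w' -> ->.
  by rewrite (clr (existT _ s b) vb) => ? ? [].
have pY : prv (set0 `|` Y) psi (fsubst rho (Ex phi)).
  apply: prv_exI.
  - by rewrite set0I.
  - by rewrite senE.2 setI0.
  - rewrite exE; apply: prv_id; split; rewrite ?senE.2//; do ?[exact: lt_kappa0|exact: senE.1].
  - by rewrite set0U; split=> //; [exact: senE.1|rewrite senE.2].
rewrite set0U in pY; have := prv_closed pY clt.
rewrite [X in prv _ _ X](_ : _ = fsubst rho (Ex phi)); last first.
  by rewrite -[RHS]fsubst_id; apply: fsubst_agree; rewrite senE.2.
apply: prv_cut; rewrite /psi fsubst_comp.
rewrite (_ : fsubst (scomp _ _) phi = fsubst (join rho tau) phi)//.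
apply: fsubst_agree => -[s [b|y]] //= vb.
by rewrite /scomp/= tsubst_closed//; exact: (clr (existT _ s b) vb).
Qed.

End Derivations.

(** * Leibniz rule for closed terms *)

Section Leibniz.
Context {d : Order.disp_t} {K : orderType d} (hK : weakly_compact K).
Context (S : signature K).
Implicit Types (B C : scope S) (X Y Z W : varset S).

(** Classically sorts have decidable equality, so the second components of
    equal variables agree. *)
Lemma svar_inj B s (b b' : B s) : existT B s b = existT B s b' -> b = b'.
Proof. by apply: inj_pair2_eq_dec => x y; exact: pselect. Qed.

Definition provably_equal B (A : set (svar B)) (rho rho' : subst B (V S)) : Prop :=
  forall v, A v -> provable (Eq (rho _ (projT2 v)) (rho' _ (projT2 v))).

(** The variables of [phi] are named in two disjoint ways, by [e] and by [f \o
    e], and the Leibniz rule is applied to the two strings of names.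
    Instantiating the first string by [rho] and the second by [rho'] gives the
    claim. Disjointness is what allows one substitution to do both, and it is
    why [f] has to avoid the range of [e]. *)
Lemma provable_subst B (phi : form B) (rho rho' : subst B (V S)) :
  wf phi -> lt_kappa K (fv phi) ->
  closed_on (fv phi) rho -> closed_on (fv phi) rho' ->
  provably_equal (fv phi) rho rho' ->
  provable (fsubst rho phi) -> provable (fsubst rho' phi).
Proof.
move=> wfp fvk cl cl' eqr p.
have [e einj] := lt_kappa_inj hK fvk.
have [f [finj fe]] := injective_avoiding hK (lt_kappa_image e fvk).
pose name : subst B (V S) := fun s b => @Var _ _ S (V S) s (e (existT _ s b)).
pose enc (v : svar B) : svar (V S) := existT (V S) (projT1 v) (e v).
pose psi := fsubst name phi.
pose W : varset S := enc @` fv phi.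
pose y : forall s : sorts S, V S s -> V S s := fun s k => f k.
pose Z := W `|` vmap y @` W.
have fvpsi : fv psi `<=` W.
  by move=> w /fv_fsubst[[s b] /= vb ->]; exists (existT _ s b).
have wfpsi : wf psi by apply: wf_fsubst => // v _ w w' -> ->.
(* The simultaneous substitution: names given by [e] go to the values of
   [rho], the shifted names [f \o e] to those of [rho']. *)
pose sigma : subst (V S) (V S) := fun s k =>
  match pselect (exists b, fv phi (existT B s b) /\ e (existT B s b) = k) with
  | left h => rho s (sval (cid h))
  | right _ =>
    match pselect (exists b, fv phi (existT B s b) /\ f (e (existT B s b)) = k) with
    | left h => rho' s (sval (cid h))
    | right _ => Var (k : V S s)
    end
  end.
have sigma1 s b : fv phi (existT B s b) -> sigma s (e (existT B s b)) = rho s b.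
  move=> vb; rewrite /sigma; case: pselect => [h|[]]; last by exists b.
  case: cid => b' /= [vb' /einj eb]; congr rho; apply: svar_inj.
  by apply: eb; apply/mem_set.
have sigma2 s b : fv phi (existT B s b) -> sigma s (f (e (existT B s b))) = rho' s b.
  move=> vb; rewrite /sigma; case: pselect => [[b' [vb' ebb]]|_].
    by case: (fe (e (existT B s b))); exists (existT B s b').
  case: pselect => [h|[]]; last by exists b.
  case: cid => b' /= [vb' /finj/einj eb]; congr rho'; apply: svar_inj.
  by apply: eb; apply/mem_set.
have clZ : closed_on Z sigma.
  move=> _ [[[s b] vb <-]|[_ [[s b] vb <-] <-]] /=.
    by rewrite sigma1//; exact: (cl (existT _ s b)).
  by rewrite /y sigma2//; exact: (cl' (existT _ s b)).
have Wk : lt_kappa K W by exact: lt_kappa_image.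
have Zk : lt_kappa K Z by apply: lt_kappaU => //; exact: lt_kappa_image.
pose x : forall s : sorts S, V S s -> V S s := fun s k => k.
have vx v : vmap x v = v by case: v.
have WZ : W `<=` Z by move=> w Ww; left.
pose phi_x := inst W (fun s k => Var (x s k)) psi.
pose phi_y := inst W (fun s k => Var (y s k)) psi.
have fvx : fv phi_x `<=` Z.
  by rewrite /phi_x instE// => w /fv_fsubst[[s k] /fvpsi/WZ Zv] ->.
have fvy : fv phi_y `<=` Z.
  by rewrite /phi_y instE// => w /fv_fsubst[v /fvpsi Wv ->]; right; exists v.
have fvE : fv (Eqs W x y) `<=` Z.
  move=> w [[v /set_mem Wv] _ /= [->|->]]; last by right; exists v.
  by left; case: v Wv.
have leib : prv Z (And2 (Eqs W x y) phi_x) phi_y.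
  apply: prv_leibniz.
  - by move=> v w _ _; rewrite !vx.
  - move=> [s k] [s' k'] _ _ ss; have /= /finj kk := congr1 (fun v => projT2 v : K) ss.
    by have /= ss' := congr1 (@projT1 _ _) ss; subst s' k'.
  - by move=> _ [v Wv <-]; rewrite vx; exact: WZ.
  - by move=> w Ww; right.
  - by move=> v /fvpsi/WZ.
  have wfx : wf phi_x by rewrite /phi_x instE//; apply: wf_fsubst => // v _ w w' -> ->.
  have wfy : wf phi_y by rewrite /phi_y instE//; apply: wf_fsubst => // v _ w w' -> ->.
  have wfE : wf (Eqs W x y).
    split=> //; last exact: lt_kappa_sub fvE Zk.
    have [WK _] := Wk; apply: card_le_trans WK.
    by move: (card_setT W); rewrite card_eqPle => -[].
  have fvA : fv (And2 (Eqs W x y) phi_x) `<=` Z by move=> w [[] _]; [exact: fvE|exact: fvx].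
  split=> //; split; [exact: le_kappa_bool|by case|exact: lt_kappa_sub fvA Zk].
have cleib := prv_closed hK leib clZ; have [_ wfl _ _ _] := prv_sequent cleib.
rewrite (_ : fsubst rho' phi = fsubst sigma phi_y); last first.
  rewrite /phi_y instE// !fsubst_comp; apply: fsubst_agree => -[s b] vb /=.
  by rewrite /scomp /= /y sigma2.
apply: prv_cut cleib; apply: provable_And => // -[]; last first.
  suff phi_xE : fsubst sigma phi_x = fsubst rho phi by rewrite -phi_xE in p.
  rewrite /phi_x instE// !fsubst_comp; apply: fsubst_agree => -[s b] vb /=.
  by rewrite /scomp /= /x sigma1.
apply: (provable_And hK); first by case: wfl => _ wfb _; exact: (wfb true).
move=> [v /set_mem /= [[s b] vb <-]] /=.
by rewrite /x /y sigma1// sigma2//; exact: (eqr (existT _ s b)).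
Qed.

Lemma provable_Eq_refl s (t : term (V S) s) : closed_term t -> provable (Eq t t).
Proof.
move=> clt; have [o _] := exists_bottom hK.
pose rho : subst (V S) (V S) := fun s' k =>
  match pselect (s = s') with
  | left e => eq_rect s (term (V S)) t s' e
  | right _ => Var k
  end.
have rhoE (k : V S s) : rho s k = t.
  by rewrite /rho; case: pselect => // e; rewrite (Prop_irrelevance e erefl).
have := @provable_closed _ _ hK S [set existT (V S) s o] rho.
move=> /(_ (Eq (Var (o : V S s)) (Var (o : V S s)))); rewrite /= rhoE; apply.
  apply: prv_refl; split=> //.
  - apply: (lt_kappa_countable hK); last by apply: finite_set_countable; exact: finite_set1.
    by apply: (@inj_le_kappa _ _ _ _ (fun=> o)) => v w /set_mem -> /set_mem ->.
  - exact: wf_Top.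
  - by move=> w [[]].
  - by move=> w [].
by move=> v ->; rewrite /= rhoE.
Qed.

(** Replace the left occurrence of [t] in [t = t]. The two occurrences are
    told apart by a scope with two variables of sort [s]. *)
Lemma provable_Eq_sym s (t u : term (V S) s) :
  closed_term t -> closed_term u -> provable (Eq t u) -> provable (Eq u t).
Proof.
move=> clt clu ptu.
pose B : scope S := fun s' => ((s = s') * bool)%type.
(* The variable [true] is the left occurrence, [false] the right one. *)
pose rho (a c : term (V S) s) : subst B (V S) := fun s' b =>
  match b.1 in _ = s' return term (V S) s' with erefl => if b.2 then a else c end.
pose phi : form B := Eq (@Var _ _ _ B s (erefl, true)) (@Var _ _ _ B s (erefl, false)).
apply: (@provable_subst B phi (rho t t) (rho u t)) => //.
- have [o _] := exists_bottom hK; split.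
    apply: (@inj_le_kappa _ _ _ _ (fun v : svar B => if (projT2 v).2 then osucc o else o)).
    move=> _ _ /set_mem[]-> /set_mem[]-> //= /eqP;
      by rewrite ?(gt_eqF (lt_osucc hK o)) ?(lt_eqF (lt_osucc hK o)).
  case: hK => _ ncK _ _ _ Kle; apply: ncK.
  by apply: card_le_trans Kle _; apply: finite_set_countable; apply: finite_set2.
- by move=> _ [] ->.
- by move=> _ [] ->.
- by move=> _ [] -> //=; exact: provable_Eq_refl.
- exact: provable_Eq_refl.
Qed.

End Leibniz.

(** * The slash *)

Section Slash.
Context {d : Order.disp_t} {K : orderType d} (hK : weakly_compact K).
Context (S : signature K).
Implicit Types (B C : scope S) (X Y Z W : varset S).

(** Aczel's variant of the slash, with an assignment in place of substituted
    formulas so that the recursion is structural. Among compound formulas only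
    implications and universal ones mention provability: this suffices for the
    slash to imply provability, and it keeps conjunction, disjunction and
    existential quantification transparent. *)
Fixpoint slash B (phi : form B) : subst B (V S) -> Prop :=
  match phi with
  | Rel R a => fun rho => provable (fsubst rho (Rel a))
  | Eq s t u => fun rho => provable (fsubst rho (Eq t u))
  | And J phi => fun rho => forall i, slash (phi i) rho
  | Or J phi => fun rho => exists i, slash (phi i) rho
  | Imp phi psi => fun rho =>
      provable (fsubst rho (Imp phi psi)) /\ (slash phi rho -> slash psi rho)
  | Ex Y phi => fun rho =>
      exists tau : subst (V S) (V S), closed_on Y tau /\ slash phi (join rho tau)
  | All Y phi => fun rho =>
      provable (fsubst rho (All phi)) /\
      forall tau : subst (V S) (V S), closed_on Y tau -> slash phi (join rho tau)
  end.

Lemma slash_fsubst B (phi : form B) C (sigma : subst B C) (rho : subst C (V S)) :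
  slash (fsubst sigma phi) rho = slash phi (scomp rho sigma).
Proof.
elim: phi C sigma rho => {B} [B R a|B s t u|B I phi IH|B I phi IH
  |B phi IHp psi IHq|B Y phi IH|B Y phi IH] C sigma rho.
- by rewrite -[LHS]/(provable (fsubst rho (fsubst sigma (Rel a)))) fsubst_comp.
- by rewrite -[LHS]/(provable (fsubst rho (fsubst sigma (Eq t u)))) fsubst_comp.
- by apply: eq_forall => i; apply: IH.
- by apply: eq_exists => i; apply: IH.
- rewrite -[LHS]/(provable (fsubst rho (fsubst sigma (Imp phi psi))) /\
    (slash (fsubst sigma phi) rho -> slash (fsubst sigma psi) rho)).
  by rewrite fsubst_comp IHp IHq.
- by apply: eq_exists => tau; congr and; rewrite -(scomp_join Y rho tau sigma); apply: IH.
- rewrite -[LHS]/(provable (fsubst rho (fsubst sigma (All phi))) /\ _) fsubst_comp.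
  congr and; apply: eq_forall => tau; apply: eq_forall => _.
  by rewrite -(scomp_join Y rho tau sigma); exact: IH.
Qed.

Lemma slash_agree B (phi : form B) (rho rho' : subst B (V S)) :
  agree (fv phi) rho rho' -> slash phi rho -> slash phi rho'.
Proof.
elim: phi rho rho' => {B} [B R a|B s t u|B I phi IH|B I phi IH
  |B phi IHp psi IHq|B Y phi IH|B Y phi IH] rho rho' rr.
- by rewrite /slash (fsubst_agree rr).
- by rewrite /slash (fsubst_agree rr).
- by move=> /= sl i; apply: IH (sl i) => v vi; apply: rr; exists i.
- by move=> /= [i sl]; exists i; apply: IH sl => v vi; apply: rr; exists i.
- move=> [p sl]; split; first by rewrite -(fsubst_agree rr).
  move=> slp; apply: IHq (sl _); first by move=> v vi; apply: rr; right.
  by apply: IHp slp => v vi; symmetry; apply: rr; left.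
- move=> [tau [cl sl]]; exists tau; split=> //; apply: IH sl.
  by move=> [s [b|y]] //= vb; apply: (rr (existT _ s b)).
- move=> [p sl]; split; first by rewrite -(fsubst_agree rr).
  move=> tau cl; apply: IH (sl _ cl).
  by move=> [s [b|y]] //= vb; apply: (rr (existT _ s b)).
Qed.

(** Where the clause does not assert provability outright, it follows from the
    parts: a conjunction, a disjunct or an instance with closed witnesses. *)
Lemma slash_provable B (phi : form B) (rho : subst B (V S)) :
  wf phi -> closed_on (fv phi) rho -> slash phi rho -> provable (fsubst rho phi).
Proof.
elim: phi rho => {B} [B R a|B s t u|B I phi IH|B I phi IH
  |B phi IHp psi IHq|B Y phi IH|B Y phi IH] rho wfp cl //.
- have [_ wfi _] := wfp; move=> sl; apply: (provable_And hK).
    by apply: (@wf_fsubst _ _ _ hK _ (And phi)) => //; exact: closed_thin.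
  move=> i; apply: IH; [exact: wfi|by move=> v vi; apply: cl; exists i|exact: sl].
- have [_ wfi _] := wfp; move=> [i sl]; apply: (provable_Or hK (i := i)).
    split; last exact: (@fv_fsubst_closed _ _ _ _ (Or phi)).
    by apply: (@wf_fsubst _ _ _ hK _ (Or phi)) => //; exact: closed_thin.
  apply: IH; [exact: wfi|by move=> v vi; apply: cl; exists i|exact: sl].
- by case.
- move=> [tau [clt sl]]; have [_ wfi] := wfp; apply: (provable_Ex hK wfp cl clt).
  apply: IH sl => //.
  exact: closed_on_join.
- by case.
Qed.

Definition provably_equal_closed B (A : set (svar B)) (rho rho' : subst B (V S)) :=
  [/\ closed_on A rho, closed_on A rho' & provably_equal A rho rho'].

Lemma provably_equal_closed_sub B (A A' : set (svar B)) (rho rho' : subst B (V S)) :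
  A' `<=` A -> provably_equal_closed A rho rho' -> provably_equal_closed A' rho rho'.
Proof.
move=> AA' [cl cl' e].
by split; [exact: closed_on_sub cl|exact: closed_on_sub cl'|move=> v /AA'/e].
Qed.

Lemma provably_equal_closed_sym B (A : set (svar B)) (rho rho' : subst B (V S)) :
  provably_equal_closed A rho rho' -> provably_equal_closed A rho' rho.
Proof.
move=> [cl cl' e]; split=> // v Av.
by apply: (provable_Eq_sym hK); [exact: cl|exact: cl'|exact: e].
Qed.

Lemma provably_equal_closed_join B Y (A : set (svar (ext B Y)))
    (rho rho' : subst B (V S)) (tau : subst (V S) (V S)) :
  closed_on Y tau -> provably_equal_closed [set v | A (inlv Y v)] rho rho' ->
  provably_equal_closed A (join rho tau) (join rho' tau).
Proof.
move=> clt [cl cl' e]; split; [exact: closed_on_join|exact: closed_on_join|].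
move=> [s [b|y]] Ab /=; first exact: (e (existT _ s b)).
by apply: (provable_Eq_refl hK); exact: (clt (existT _ s (sval y)) (svalP y)).
Qed.

(** Provability in the atomic, implication and universal clauses transfers by
    [provable_subst]. An implication uses the converse transfer for its
    premise, hence the symmetric relation. *)
Lemma slash_congr B (phi : form B) (rho rho' : subst B (V S)) :
  wf phi -> lt_kappa K (fv phi) -> provably_equal_closed (fv phi) rho rho' ->
  slash phi rho -> slash phi rho'.
Proof.
elim: phi rho rho' => {B} [B R a|B s t u|B I phi IH|B I phi IH
  |B phi IHp psi IHq|B Y phi IH|B Y phi IH] rho rho' wfp fvk.
- by move=> [cl cl' e]; apply: (provable_subst hK).
- by move=> [cl cl' e]; apply: (provable_subst hK).
- have [_ wfi _] := wfp; move=> e sl i.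
  have fvi : fv (phi i) `<=` fv (And phi) by move=> v vi; exists i.
  apply: IH (sl i); [exact: wfi|exact: lt_kappa_sub fvk|].
  exact: provably_equal_closed_sub e.
- have [_ wfi _] := wfp; move=> e [i sl]; exists i.
  have fvi : fv (phi i) `<=` fv (Or phi) by move=> v vi; exists i.
  apply: IH sl; [exact: wfi|exact: lt_kappa_sub fvk|].
  exact: provably_equal_closed_sub e.
- move=> e [p sl]; have [cl cl' e'] := e; have [wfphi wfpsi] := wfp.
  split; first exact: (provable_subst hK) p.
  have fvp : fv phi `<=` fv (Imp phi psi) by move=> v vi; left.
  have fvq : fv psi `<=` fv (Imp phi psi) by move=> v vi; right.
  move=> slp; apply: IHq (sl _) => //.
  + exact: lt_kappa_sub fvk.
  + exact: provably_equal_closed_sub e.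
  apply: IHp slp => //; first exact: lt_kappa_sub fvk.
  by apply: provably_equal_closed_sym; exact: provably_equal_closed_sub e.
- move=> e [tau [clt sl]]; exists tau; split=> //; have [Yk wfphi] := wfp.
  apply: IH sl => //; first exact: lt_kappa_fv_ext.
  exact: provably_equal_closed_join.
- move=> e [p sl]; have [cl cl' e'] := e; have [Yk wfphi] := wfp.
  split; first exact: (provable_subst hK) p.
  move=> tau clt; apply: IH (sl _ clt) => //; first exact: lt_kappa_fv_ext.
  exact: provably_equal_closed_join.
Qed.

End Slash.

(** * Branches of trees *)

Section Trees.
Context {d : Order.disp_t} {K : orderType d} (hK : weakly_compact K).
Variable G : Type.

(** Nodes are dependent pairs; this reduces their equality to levels and
    values, whatever proofs of membership the values are taken at. *)
Lemma eq_node (a b : K) (f : seg a -> G) (g : seg b -> G) :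
  a = b ->
  (forall c (ca : c < a) (cb : c < b), f (exist _ c ca) = g (exist _ c cb)) ->
  existT (fun a : K => seg a -> G) a f = existT (fun a : K => seg a -> G) b g.
Proof.
move=> ab; case: b / ab g => g fg; congr existT; apply/funext => -[c ca]; exact: fg.
Qed.

Lemma eq_branch_node (h h' : K -> G) a :
  (forall b, b < a -> h b = h' b) -> branch_node h a = branch_node h' a.
Proof. by move=> hh; apply: eq_node => // c ca cb /=; exact: hh. Qed.

Lemma restr_branch (h : K -> G) a b :
  restr (branch_node h a) b = branch_node h (Order.min b a).
Proof. exact: eq_node. Qed.

Lemma restr_branch_le (h : K -> G) a b :
  b <= a -> restr (branch_node h a) b = branch_node h b.
Proof. by move=> ba; rewrite restr_branch min_l. Qed.

Lemma extends_branch f (h : K -> G) a :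
  extends f (branch_node h a) -> lvl f <= a /\ f = branch_node h (lvl f).
Proof.
rewrite /extends restr_branch => fE; have := congr1 (@lvl _ _ _) fE; rewrite /= => lE.
by split; [rewrite -lE ge_min lexx orbT|rewrite -[LHS]fE lE].
Qed.

Lemma child_branch (h : K -> G) a (t : G) :
  child (branch_node h a) (branch_node (upd h a t) (osucc a)).
Proof.
split=> //; rewrite /extends restr_branch_le ?ltW ?lt_osucc//.
by apply: eq_branch_node => b ba; rewrite upd_lt.
Qed.

(** A node read as a partial function on all ordinals, so that an equality of
    nodes can be evaluated at one place. *)
Definition value_at (f : node K G) (c : K) : option G :=
  match pselect (c < lvl f) with
  | left cf => Some (projT2 f (exist _ c cf))
  | right _ => None
  end.

Lemma value_atE (f : node K G) (c : K) (cf : c < lvl f) :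
  value_at f c = Some (projT2 f (exist _ c cf)).
Proof.
rewrite /value_at; case: pselect => // cf'; congr Some; congr (projT2 f _).
by congr exist; exact: Prop_irrelevance.
Qed.

(** Every child arises by prescribing one more value; this connects the rules,
    which quantify over children, with functions defined on all of kappa. *)
Lemma child_branchP (h : K -> G) a (g : node K G) :
  child (branch_node h a) g -> exists t, g = branch_node (upd h a t) (osucc a).
Proof.
case: g => l g [/= lE]; rewrite /lvl/= in lE; subst l => /= ext_g.
exists (g (exist _ a (lt_osucc hK a))).
apply: eq_node => // c ca ca' /=; rewrite /upd; case: eqP => [ca0|/eqP ca0].
  by subst c; congr g; congr exist; exact: Prop_irrelevance.
have ca2 : c < a by rewrite lt_neqAle ca0 -(lt_osuccE hK).
have := congr1 (fun f => value_at f c) ext_g.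
rewrite (@value_atE (branch_node h a) c ca2) value_atE /= => [|cr].
  by rewrite lt_min ca2 ca.
by move=> [<-]; congr g; congr exist; exact: Prop_irrelevance.
Qed.

Lemma child_inhabited (f g : node K G) : child f g -> inhabited G.
Proof.
move=> [lE _]; have fg : lvl f < lvl g by rewrite lE lt_osucc.
by constructor; exact: (projT2 g (exist _ (lvl f) fg)).
Qed.

Lemma root_branch (r : node K G) (h : K -> G) a :
  is_root r -> (forall b, a <= b) -> branch_node h a = r.
Proof.
move=> rr a0; case: r rr => l r rr; apply: eq_node => [|c ca].
  by apply/eqP; rewrite eq_le a0 rr.
by move: (a0 c); rewrite leNgt ca.
Qed.

(** The least level at which the branch lies in the bar is minimal in the bar,
    because all nodes below it lie on the same branch. *)
Lemma branch_meets_bar (U : set (node K G)) (h : K -> G) :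
  is_bar U -> exists a, minimal_nodes U (branch_node h a).
Proof.
move=> [_ /(_ h)[a Ua]].
have [b Ub bmin] := @weakly_compact_least _ _ hK [set b | U (branch_node h b)]
  (ex_intro _ a Ua).
exists b; split=> // g Ug /extends_branch[lb gE].
rewrite gE; congr branch_node; apply/eqP; rewrite eq_le lb /=.
by apply: bmin; rewrite /= -gE.
Qed.

End Trees.

(** * Soundness of the slash *)

Section Soundness.
Context {d : Order.disp_t} {K : orderType d} (hK : weakly_compact K).
Context (S : signature K).
Implicit Types (B C : scope S) (X Y Z W : varset S).

(** Only the context is required to take closed values, as in semantics with
    possibly empty sorts. *)
Definition preserves_slash X (phi psi : form (V S)) : Prop :=
  forall rho : subst (V S) (V S), closed_on X rho -> slash phi rho -> slash psi rho.

(** The assignment [rho] changed to [tau] on [Y]; this is what an assignment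
    of witnesses for [ex_ Y phi] does to [phi]. *)
Definition override Y (tau rho : subst (V S) (V S)) : subst (V S) (V S) :=
  fun s k => if pselect (Y (existT _ s k)) then tau s k else rho s k.

Lemma scomp_join_bind Y (rho tau : subst (V S) (V S)) :
  scomp (join rho tau) (@bind _ _ S Y) = override Y tau rho.
Proof.
apply: functional_extensionality_dep => s; apply: functional_extensionality_dep => k.
by rewrite /scomp /bind /override; case: pselect.
Qed.

Lemma slash_ex_ Y phi (rho : subst (V S) (V S)) :
  slash (ex_ Y phi) rho <->
  exists2 tau, closed_on Y tau & slash phi (override Y tau rho).
Proof.
have slE tau : slash phi (override Y tau rho) =
    slash (fsubst (@bind _ _ S Y) phi) (join rho tau).
  by rewrite slash_fsubst scomp_join_bind.
split=> [[tau [clt sl]]|[tau clt sl]]; exists tau => //; first by rewrite slE.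
by rewrite slE in sl.
Qed.

Lemma slash_all_ Y phi (rho : subst (V S) (V S)) :
  slash (all_ Y phi) rho <->
  provable (fsubst rho (all_ Y phi)) /\
  forall tau, closed_on Y tau -> slash phi (override Y tau rho).
Proof.
have slE tau : slash phi (override Y tau rho) =
    slash (fsubst (@bind _ _ S Y) phi) (join rho tau).
  by rewrite slash_fsubst scomp_join_bind.
split=> -[p sl]; split=> // tau /sl; first by rewrite slE.
by rewrite slE.
Qed.

Lemma closed_on_override X Y (tau rho : subst (V S) (V S)) :
  closed_on X rho -> closed_on Y tau -> closed_on (X `|` Y) (override Y tau rho).
Proof.
move=> clr clt [s k] /= XYk; rewrite /override; case: pselect => Yk.
  exact: (clt (existT _ s k)).
by case: XYk => // Xk; exact: (clr (existT _ s k)).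
Qed.

Lemma agree_override X Y (tau rho : subst (V S) (V S)) :
  Y `&` X = set0 -> agree X (override Y tau rho) rho.
Proof.
move=> YX [s k] Xk /=; rewrite /override; case: pselect => // Yk.
by have : (Y `&` X) (existT _ s k) by []; rewrite YX.
Qed.

Lemma override_id Y (rho : subst (V S) (V S)) : override Y rho rho = rho.
Proof.
apply: functional_extensionality_dep => s; apply: functional_extensionality_dep => k.
by rewrite /override; case: pselect.
Qed.

Lemma slash_AndS (T : Type) (A : set T) (phi : T -> form (V S)) rho :
  slash (AndS A phi) rho <-> forall x, A x -> slash (phi x) rho.
Proof.
split=> [sl x Ax|sl [x Ax]]; first exact: (sl (SigSub (mem_set Ax))).
exact: (sl x (set_mem Ax)).
Qed.

Lemma slash_OrS (T : Type) (A : set T) (phi : T -> form (V S)) rho :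
  slash (OrS A phi) rho <-> exists2 x, A x & slash (phi x) rho.
Proof.
split=> [[[x Ax] sl]|[x Ax sl]]; first by exists x => //; exact: (set_mem Ax).
by exists (SigSub (mem_set Ax)).
Qed.

(** For the rules introducing implications and universal formulas, whose slash
    asserts provability: the slash of the left-hand side proves it, and the
    derivation carries the proof over to the right-hand side. *)
Lemma provable_of_slash X phi psi (rho : subst (V S) (V S)) :
  prv X phi psi -> closed_on X rho -> slash phi rho -> provable (fsubst rho psi).
Proof.
move=> p cl sl; have [_ wfp _ fvp _] := prv_sequent p.
apply: prv_cut (prv_closed hK p cl).
by apply: (slash_provable hK) => //; exact: closed_on_sub cl.
Qed.

(** The two instances of [phi] are slashes of the same formula under two
    assignments, which agree outside [W] and are provably equal on [W] by the
    equations. *)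
Lemma preserves_leibniz W Z (x y : forall s : sorts S, V S s -> V S s) phi :
  vmap x @` W `<=` Z -> vmap y @` W `<=` Z -> fv phi `<=` Z ->
  let phi_x := inst W (fun s k => Var (x s k)) phi in
  let phi_y := inst W (fun s k => Var (y s k)) phi in
  sequent Z (And2 (Eqs W x y) phi_x) phi_y ->
  preserves_slash Z (And2 (Eqs W x y) phi_x) phi_y.
Proof.
move=> xZ yZ fvZ phi_x phi_y [Zk _ wfy _ _] rho cl sl.
have fvk : lt_kappa K (fv phi) by exact: lt_kappa_sub Zk.
have wfp : wf phi by apply: wf_of_fsubst wfy.
have /slash_AndS slE : slash (Eqs W x y) rho := sl true.
have : slash phi_x rho := sl false.
rewrite /phi_x /phi_y /inst !slash_fsubst; apply: (slash_congr hK) => //.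
have tfv_rho s k : Z (existT _ s k) -> closed_term (rho s k).
  exact: (cl (existT _ s k)).
split=> -[s k] /= /fvZ Zk'; rewrite /scomp; case: pselect => Wk //=.
- by apply: tfv_rho; apply: xZ; exists (existT _ s k).
- exact: tfv_rho.
- by apply: tfv_rho; apply: yZ; exists (existT _ s k).
- exact: tfv_rho.
- exact: (slE _ Wk).
- by apply: (provable_Eq_refl hK); exact: tfv_rho.
Qed.

(** By contradiction: from a root that is not slashed one climbs through nodes
    that are not slashed. A child of this kind exists by the premises for
    successor levels, and a limit of such nodes is again one since a slashed
    limit node has a slashed restriction. Where the branch meets the bar, the
    left-hand side yields a slashed node on it. *)
Lemma preserves_dual_distr X (G : Type) (phi : node K G -> form (V S))
    (U : set (node K G)) (r : node K G) :
  is_bar U -> is_root r ->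
  (forall f, preserves_slash X (AndS (child f) phi) (phi f)) ->
  (forall f, is_limit (lvl f) ->
    preserves_slash X (phi f) (Or (fun a : seg (lvl f) => phi (restr f (sval a))))) ->
  preserves_slash X
    (AndS (minimal_nodes U) (fun f =>
       Or (fun b : seg (lvl f) => phi (restr f (osucc (sval b))))))
    (phi r).
Proof.
move=> Ubar rr hchild hlim rho cl /slash_AndS slB; apply: contrapT => nsl.
have bad_child f : ~ slash (phi f) rho -> exists2 g, child f g & ~ slash (phi g) rho.
  move=> nf; apply: contrapT => nch; apply: nf; apply: (hchild f _ cl).
  by apply/slash_AndS => g fg; apply: contrapT => ng; apply: nch; exists g.
(* A child of the root shows that there is a label to start a branch with. *)
have [g0 rg0 _] := bad_child r nsl.
have [||||h nh] := @transfinite_branch _ _ hK G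
  (fun a h => ~ slash (phi (branch_node h a)) rho) (child_inhabited hK rg0).
- by move=> a h h' hh'; rewrite (eq_branch_node hh').
- by move=> a h a0; rewrite (root_branch h rr a0).
- move=> a h /bad_child[g /(child_branchP hK)[t ->] ng]; by exists t.
- move=> a h la hlow /(hlim (branch_node h a) la _ cl)[[b ba] /=].
  by rewrite restr_branch_le ?ltW//; exact: hlow.
have [a /slB[[b ba] /=]] := branch_meets_bar hK h Ubar.
by rewrite restr_branch_le ?osucc_le//; exact: nh.
Qed.

Section TransfiniteTransitivity.
Variables (G : Type) (phi : node K G -> form (V S)) (x : node K G -> varset S).
Hypothesis fv_child : forall f g, child f g ->
  fv (phi g) = fv (phi f) `|` x g /\ x g `&` fv (phi f) = set0.
Hypothesis fv_limit : forall f, is_limit (lvl f) ->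
  fv (phi f) = \bigcup_(a in [set: seg (lvl f)]) fv (phi (restr f (sval a))).

Lemma fv_branch_mono (h : K -> G) a b :
  a <= b -> fv (phi (branch_node h a)) `<=` fv (phi (branch_node h b)).
Proof.
move: b; apply: (lt_ind hK) => b IH ab.
have [->//|nab] := eqVneq a b.
have {}ab : a < b by rewrite lt_neqAle nab.
have [b0|[c cb bE]|lb] := ordinal_cases hK b.
- by have := b0 a; rewrite leNgt ab.
- have ac : a <= c by rewrite -(lt_osuccE hK) -bE.
  have := fv_child (child_branch hK h c (h c)); rewrite upd_id -bE => -[-> _].
  by move=> v va; left; exact: IH va.
- move=> v va; rewrite (fv_limit (f := branch_node h b) lb).
  by exists (exist _ a ab) => //=; rewrite restr_branch_le// ltW.
Qed.

(** The witnesses collected on the way up have to cover exactly the variables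
    that the conclusion of the rule quantifies; all others are free at the
    root, where the given assignment decides. *)
Lemma fv_branch (h : K -> G) r a : is_root r ->
  fv (phi (branch_node h a)) `<=`
  fv (phi r) `|` \bigcup_(b in [set b | b < a]) x (branch_node h (osucc b)).
Proof.
move=> rr; move: a; apply: (lt_ind hK) => a IH.
have [a0|[c ca aE]|la] := ordinal_cases hK a.
- by rewrite (root_branch h rr a0) => v va; left.
- have := fv_child (child_branch hK h c (h c)); rewrite upd_id -aE => -[-> _].
  move=> v [/(IH _ ca)[vr|[b bc vb]]|vx]; first by left.
    by right; exists b => //; exact: lt_trans ca.
  by right; exists c => //=; rewrite -aE.
- rewrite (fv_limit (f := branch_node h a) la) => v [[b ba] _ /=].
  rewrite restr_branch_le ?ltW// => /(IH _ ba)[vr|[c cb vc]]; first by left.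
  by right; exists c => //; exact: lt_trans ba.
Qed.

(** A step of the walk records the next value on the branch together with the
    assignment reached before taking the step. *)
Definition stage := (G * subst (V S) (V S))%type.

(** The invariant of the walk. Keeping all earlier nodes slashed, and the
    assignment coherent with the earlier ones recorded in [h], is what makes
    it possible to glue at limit levels. *)
Definition realized (rho0 : subst (V S) (V S)) (r : node K G) (a : K)
    (h : K -> stage) : Prop :=
  exists rho : subst (V S) (V S),
    let phi_ b := phi (branch_node (fst \o h) b) in
    [/\ closed_on (fv (phi_ a)) rho,
        agree (fv (phi r)) rho rho0,
        forall b, b <= a -> slash (phi_ b) rho &
        forall b, b < a -> agree (fv (phi_ b)) rho (h b).2].

Hypothesis hchild : forall f, preserves_slash (fv (phi f)) (phi f)
  (OrS (child f) (fun g => ex_ (x g) (phi g))).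
Hypothesis hlim : forall f, is_limit (lvl f) ->
  preserves_slash (fv (phi f))
    (And (fun a : seg (lvl f) => phi (restr f (sval a)))) (phi f).

Lemma realized_local rho0 r a (h h' : K -> stage) :
  (forall b, b < a -> h b = h' b) -> realized rho0 r a h -> realized rho0 r a h'.
Proof.
move=> hh' [rho [/= cl ag sl coh]]; exists rho => /=.
have nodeE b : b <= a -> branch_node (fst \o h') b = branch_node (fst \o h) b.
  by move=> ba; apply: eq_branch_node => c cb /=; rewrite hh'//; exact: lt_le_trans ba.
split=> //; first by rewrite nodeE.
  by move=> b ba; rewrite nodeE//; exact: sl.
by move=> b ba; rewrite nodeE ?ltW// -hh'//; exact: coh.
Qed.

Lemma realized_root rho0 r a (h : K -> stage) :
  is_root r -> closed_on (fv (phi r)) rho0 -> slash (phi r) rho0 ->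
  (forall b, a <= b) -> realized rho0 r a h.
Proof.
move=> rr cl sl a0; exists rho0 => /=; rewrite (root_branch _ rr a0); split=> //.
- by move=> b ba; rewrite (root_branch _ rr)// => c; exact: le_trans ba (a0 c).
- by move=> b; rewrite ltNge a0.
Qed.

(** The premise at the current node gives a child and closed witnesses for its
    new variables; since these are new, overriding the assignment at them
    disturbs nothing established before. *)
Lemma realized_succ rho0 r a (h : K -> stage) :
  is_root r -> realized rho0 r a h ->
  exists t, realized rho0 r (osucc a) (upd h a t).
Proof.
move=> rr [rho [/= cl ag sl coh]].
have /slash_OrS[g fg /slash_ex_[tau clt slg]] := hchild cl (sl _ (lexx a)).
have [fvg disj] := fv_child fg.
have [t gE] := child_branchP hK fg.
exists (t, rho); exists (override (x g) tau rho) => /=.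
have nodeE b : b <= a ->
    branch_node (fst \o upd h a (t, rho)) b = branch_node (fst \o h) b.
  move=> ba; apply: eq_branch_node => c cb /=; rewrite upd_lt//; exact: lt_le_trans ba.
have gE' : branch_node (fst \o upd h a (t, rho)) (osucc a) = g.
  by rewrite gE; apply: eq_branch_node => c _; rewrite /upd /=; case: eqP.
have agr b : b <= a ->
    agree (fv (phi (branch_node (fst \o h) b))) (override (x g) tau rho) rho.
  by move=> ba; apply: agree_sub (agree_override tau rho disj); exact: fv_branch_mono.
split.
- by rewrite gE' fvg; exact: closed_on_override.
- move=> v vr; rewrite -(ag v vr).
  have [o omin] := exists_bottom hK.
  by apply: (agr o (omin a)); rewrite (root_branch _ rr omin).
- move=> b; rewrite le_eqVlt => /orP[/eqP ->|]; first by rewrite gE'.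
  rewrite (lt_osuccE hK) => ba; rewrite nodeE//.
  by apply: slash_agree (sl b ba); apply: agree_sym; exact: agr.
- move=> b; rewrite (lt_osuccE hK) => ba; rewrite nodeE//.
  move: ba; rewrite le_eqVlt => /orP[/eqP ->|ba].
    by rewrite /upd eqxx /=; exact: agr.
  by rewrite upd_lt// => v vb; rewrite (agr b (ltW ba) v vb); exact: coh.
Qed.

(** The recorded assignments agree wherever two of them are relevant, because
    the one reached just above both of them restricts to each; so they glue to
    an assignment of the variables of the limit node, all of which occur at
    earlier nodes. There the conjunction of the earlier nodes is slashed, and
    the limit premise applies. *)
Lemma realized_limit rho0 r a (h : K -> stage) :
  is_root r -> is_limit a -> (forall b, b < a -> realized rho0 r b h) ->
  realized rho0 r a h.
Proof.
move=> rr la low; have [[o oa] asucc] := la.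
pose phi_ b := phi (branch_node (fst \o h) b).
have coherent b c v : b < a -> c < a -> fv (phi_ b) v -> fv (phi_ c) v ->
    (h b).2 _ (projT2 v) = (h c).2 _ (projT2 v).
  wlog bc : b c / b <= c => [wl|] ba ca vb vc.
    by have [/wl|/ltW/wl wl'] := leP b c; [apply|symmetry; apply: wl'].
  have [rho [_ _ _ coh]] := low _ (asucc c ca).
  by rewrite -(coh b) ?(lt_osuccE hK)// -(coh c) ?lt_osucc.
pose rho : subst (V S) (V S) := fun s k =>
  match pselect (exists b, b < a /\ fv (phi_ b) (existT _ s k)) with
  | left e => (h (sval (cid e))).2 s k
  | right _ => Var (k : V S s)
  end.
have rhoE b : b < a -> agree (fv (phi_ b)) rho (h b).2.
  move=> ba [s k] vb; rewrite /rho /=; case: pselect => [e|[]]; last by exists b.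
  case: cid => c [ca vc] /=; exact: (coherent c b (existT _ s k)).
have fvE : fv (phi_ a) = \bigcup_(b in [set b | b < a]) fv (phi_ b).
  rewrite {1}/phi_ (fv_limit (f := branch_node _ a) la).
  apply/seteqP; split=> [v [[b ba] _ /=]|v [b ba vb]].
    by rewrite restr_branch_le ?ltW// => vb; exists b.
  by exists (exist _ b ba) => //=; rewrite restr_branch_le ?ltW.
have cl : closed_on (fv (phi_ a)) rho.
  rewrite fvE => v [b ba vb]; rewrite (rhoE b)//.
  have [rho' [cl' _ _ coh]] := low _ (asucc b ba).
  rewrite -(coh b) ?lt_osucc//; apply: cl'.
  by apply: fv_branch_mono vb; rewrite ltW ?lt_osucc.
have sl_low b : b < a -> slash (phi_ b) rho.
  move=> ba; have [rho' [_ _ sl' coh]] := low _ (asucc b ba).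
  apply: slash_agree (sl' b _); last by rewrite ltW ?lt_osucc.
  by move=> v vb; rewrite (rhoE b)// (coh b) ?lt_osucc.
exists rho; split=> //.
- have [z zmin] := exists_bottom hK.
  have za : z < a by exact: le_lt_trans (zmin o) oa.
  have zr : branch_node (fst \o h) z = r by exact: root_branch.
  have [rho' [_ ag _ coh]] := low _ (asucc z za).
  move=> v vr; rewrite -(ag v vr) (rhoE z)//; last by rewrite /phi_ zr.
  by rewrite (coh z) ?lt_osucc// zr.
- move=> b; rewrite le_eqVlt => /orP[/eqP ->|]; last exact: sl_low.
  apply: (hlim (f := branch_node _ a) la) => // -[b' ba'] /=.
  by rewrite restr_branch_le ?ltW//; exact: sl_low.
Qed.

(** At the place where the branch meets the bar, the assignment reached there
    supplies the witnesses for all variables quantified simultaneously, and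
    its invariant says that every node on the way is slashed. *)
Lemma preserves_transfinite_trans (U : set (node K G)) (r : node K G) :
  is_bar U -> is_root r ->
  preserves_slash (fv (phi r)) (phi r)
    (OrS (minimal_nodes U) (fun f =>
      ex_ (\bigcup_(b in [set: seg (lvl f)]) x (restr f (osucc (sval b))))
          (And (fun b : seg (lvl f) => phi (restr f (osucc (sval b))))))).
Proof.
move=> Ubar rr rho0 cl0 sl0.
have /slash_OrS[g0 rg0 _] := hchild cl0 sl0.
have [|||||h hP] := @transfinite_branch _ _ hK stage (realized rho0 r).
- by have [t] := child_inhabited hK rg0; constructor; exact: (t, rho0).
- exact: realized_local.
- by move=> a h; exact: realized_root.
- by move=> a h; exact: realized_succ.
- by move=> a h; exact: realized_limit.
have [a Ua] := branch_meets_bar hK (fst \o h) Ubar.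
have [rho [cl ag sl _]] := hP a.
apply/slash_OrS; exists (branch_node (fst \o h) a) => //.
apply/slash_ex_; exists rho.
  move=> v [[b ba] _ /=]; rewrite restr_branch_le ?osucc_le// => vx.
  have sub := @fv_branch_mono (fst \o h) _ _ (osucc_le hK ba).
  apply: cl; apply: sub.
  have := fv_child (child_branch hK (fst \o h) b (h b).1).
  by rewrite -[(h b).1]/((fst \o h) b) upd_id => -[-> _]; right.
move=> [b ba] /=; rewrite restr_branch_le ?osucc_le//.
apply: slash_agree (sl _ (osucc_le hK ba)) => -[s k] /= vb.
rewrite /override; case: pselect => // nx.
have [vr|[c cb vc]] := fv_branch rr vb; first exact: (ag _ vr).
case: nx; have ca : c < a by apply: le_lt_trans ba; rewrite -(lt_osuccE hK).
by exists (exist _ c ca) => //=; rewrite restr_branch_le ?osucc_le.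
Qed.

End TransfiniteTransitivity.

(** Induction on the derivation; the premises at limit levels sit inside
    conjunctions, hence the explicit fixpoint. Small distributivity is sound
    because a formula either is slashed or is not. *)
Lemma prv_preserves_slash X phi psi : prv X phi psi -> preserves_slash X phi psi.
Proof.
move: X phi psi; fix IH 4 => X phi psi [].
- by move=> {}X {}phi _ rho.
- move=> {}X Y {}phi {}psi sigma p sigmaY _ rho cl; rewrite /inst !slash_fsubst.
  apply: (IH _ _ _ p) => -[s k] Xk /=; rewrite /scomp /=.
  case: (pselect (X (existT _ s k))) => //= _.
  by apply: tfv_closed_on; apply: closed_on_sub cl; exact: (sigmaY (existT _ s k)).
- move=> {}X {}phi {}psi theta p q rho cl sl.
  exact: (IH _ _ _ q _ cl (IH _ _ _ p _ cl sl)).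
- move=> s k t _ rho cl _; apply: (provable_Eq_refl hK).
  exact: (cl (existT _ s k)).
- by move=> W Z x y {}phi _ _ xZ yZ fvZ phi_x phi_y; exact: preserves_leibniz.
- by move=> {}X I {}phi j _ rho cl; apply.
- by move=> {}X I {}phi {}psi p _ rho cl sl i; exact: (IH _ _ _ (p i) _ cl sl).
- by move=> {}X I {}phi j _ rho cl sl; exists j.
- by move=> {}X I {}phi theta p _ rho cl [i sl]; exact: (IH _ _ _ (p i) _ cl sl).
- move=> {}X {}phi {}psi eta p sq rho cl sl; split.
    by apply: provable_of_slash (prv_impI p sq) cl sl.
  by move=> slp; apply: (IH _ _ _ p _ cl) => -[].
- move=> {}X {}phi {}psi eta p _ rho cl sl.
  exact: (IH _ _ _ p _ cl (sl true)).2 (sl false).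
- move=> {}X Y {}phi {}psi XY Ypsi p _ rho cl /slash_ex_[tau clt sl].
  apply: slash_agree (agree_override tau rho Ypsi) _.
  by apply: (IH _ _ _ p _ _ sl); exact: closed_on_override.
- move=> {}X Y {}phi {}psi XY Ypsi p _ rho cl sl.
  apply: (IH _ _ _ p rho); first by apply: closed_on_sub cl => v Xv; left.
  apply/slash_ex_; exists rho; last by rewrite override_id.
  by apply: closed_on_sub cl => v Yv; right.
- move=> {}X Y {}phi {}psi XY Yphi p sq rho cl sl; apply/slash_all_; split.
    by apply: provable_of_slash (prv_allI XY Yphi p sq) cl sl.
  move=> tau clt; apply: (IH _ _ _ p); first exact: closed_on_override.
  by apply: slash_agree sl; apply: agree_sym; exact: agree_override.
- move=> {}X Y {}phi {}psi XY Yphi p _ rho cl sl.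
  have clX : closed_on X rho by apply: closed_on_sub cl => v Xv; left.
  have /slash_all_[_ sla] := IH _ _ _ p rho clX sl.
  rewrite -[rho](override_id Y); apply: sla.
  by apply: closed_on_sub cl => v Yv; right.
- move=> {}X I {}phi {}psi lhs rhs _ rho cl sl.
  have [slp|nsl] := pselect (slash phi rho); first by exists true.
  by exists false => i; have [[//|slq]] := sl i.
- move=> {}X G {}phi U r _ Ubar rr hchild hlim lhs _.
  apply: preserves_dual_distr Ubar rr _ _.
    by move=> f; exact: (IH _ _ _ (hchild f)).
  by move=> f lf; case: (hlim f lf) => p _; exact: (IH _ _ _ p).
- move=> G {}phi x U r _ Ubar rr fvc fvl hchild hlim rhs _.
  apply: preserves_transfinite_trans fvc fvl _ _ _ _ Ubar rr.
    by move=> f; exact: (IH _ _ _ (hchild f)).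
  by move=> f lf; case: (hlim f lf) => _ p; exact: (IH _ _ _ p).
Qed.

End Soundness.

(** * Disjunction and existence properties *)

Theorem corollary2p2p5 (d : Order.disp_t) (K : orderType d)
    (hK : weakly_compact K) (S : signature K)
    (hS : exists c : funsym S, is_constant c) :
  (forall phi : K -> form (V S),
     (forall i, sentence (phi i)) ->
     provable (Or phi) ->
     exists i, provable (phi i)) /\
  (forall (X : varset S) (phi : form (V S)),
     sentence (ex_ X phi) ->
     provable (ex_ X phi) ->
     exists t : forall s : sorts S, V S s -> term (V S) s,
       (forall v, X v -> closed_term (t _ (projT2 v))) /\
       provable (inst X t phi)).
Proof.
have slash_of (phi : form (V S)) : provable phi -> slash phi (@idsubst _ _ S (V S)).
  by move=> /(prv_preserves_slash hK); apply.
split=> [phi sen /slash_of[i sl]|X phi [wfE fvE] /slash_of[t [clt sl]]].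
  exists i; have [wfi fvi] := sen i; rewrite -[phi i]fsubst_id.
  by apply: (slash_provable hK) => //; rewrite fvi.
exists t; split=> //.
have [_ wfp] := wfE.
have : provable (fsubst (join (@idsubst _ _ S (V S)) t) (fsubst (@bind _ _ S X) phi)).
  apply: (slash_provable hK) => //; apply: closed_on_join => //.
  by move=> v vb; have : fv (ex_ X phi) v := vb; rewrite fvE.
by rewrite fsubst_comp scomp_join_bind.
Qed.
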